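(* Let $k$ be a commutative ring such that $\mathrm{sfli}\,k<\infty$ and let $G$ be a group. Then $\mathrm{Ghd}_k G \leq \mathrm{Gcd}_k G$.
   Context: Rings are associative and unital; modules are left modules unless otherwise specified. For a ring $R$, $\mathrm{sfli}\,R$ is the supremum (in $\mathbb{N}\cup\{\infty\}$) of the flat dimensions of all injective left $R$-modules. An acyclic (i.e. exact, unbounded) complex $\mathbf{P}$ of projective $R$-modules is a complete projective resolution if $\mathrm{Hom}_R(\mathbf{P},Q)$ is acyclic for every projective $R$-module $Q$; a module is Gorenstein projective if it is a syzygy of a complete projective resolution. The Gorenstein projective dimension $\mathrm{Gpd}_R M$ is the length of a shortest resolution of $M$ by Gorenstein projective modules ($\infty$ if there is none of finite length). An acyclic complex $\mathbf{F}$ of flat $R$-modules is a complete flat resolution if $I\otimes_R\mathbf{F}$ is acyclic for every injective right $R$-module $I$; a module is Gorenstein flat if it is a syzygy of a complete flat resolution. The Gorenstein flat dimension $\mathrm{Gfd}_R M$ is the length of a shortest resolution of $M$ by Gorenstein flat modules ($\infty$ if there is none of finite length). For a group $G$ and commutative ring $k$, with $k$ regarded as the trivial $kG$-module: $\mathrm{Ghd}_kG=\mathrm{Gfd}_{kG}k$ (Gorenstein homological dimension of $G$ over $k$) and $\mathrm{Gcd}_kG=\mathrm{Gpd}_{kG}k$ (Gorenstein cohomological dimension of $G$ over $k$). *)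

(* Defs.v *)
From HB Require Import structures.
From mathcomp Require Import all_boot all_algebra finmap.
From mathcomp Require Import boolp.
From mathcomp Require Import monalg.

Set Implicit Arguments.
Unset Strict Implicit.
Unset Printing Implicit Defensive.

Import GRing.Theory.

Local Open Scope ring_scope.

Inductive enat : Type := Fin of nat | Infty.

Definition leE (a b : enat) : bool :=
  match a, b with
  | _, Infty => true
  | Infty, Fin _ => false
  | Fin m, Fin n => (m <= n)%N
  end.

Definition ltE (a b : enat) : bool := ~~ leE b a.

Definition least (P : nat -> Prop) : enat :=
  if pselect (exists n, `[< P n >]) is left ex then Fin (ex_minn ex) else Infty.

Definition esup (D : enat -> Prop) : enat :=
  least (fun n => forall a, D a -> leE a (Fin n)).

Lemma least_leP (P : nat -> Prop) (n : nat) :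
  leE (least P) (Fin n) <-> exists2 m, (m <= n)%N & P m.
Proof.
rewrite /least; case: pselect => [ex|nex] /=.
  case: ex_minnP => m /asboolP Pm minm; split=> [le_mn|[p le_pn Pp]].
    by exists m.
  by apply: leq_trans le_pn; apply/minm/asboolP.
by split=> // -[m _ Pm]; case: nex; exists m; apply/asboolP.
Qed.

Lemma zmod_morphism0 (U V : zmodType) (f : U -> V) : zmod_morphism f -> f 0 = 0.
Proof. by move=> fB; rewrite -(subrr 0) fB subrr. Qed.

Lemma zmod_morphismD (U V : zmodType) (f : U -> V) :
  zmod_morphism f -> {morph f : x y / x + y >-> x + y}.
Proof.
move=> fB x y; rewrite -{1}[y]opprK -[- y]sub0r !fB (zmod_morphism0 fB).
by rewrite sub0r opprK.
Qed.

Section FiniteSum.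
Context {K : choiceType} {A H : zmodType}.
Implicit Types (F : K -> A -> H) (g : {malg A[K]}).

Definition msum F g : H := \sum_(k <- msupp g) F k g@_k.

Lemma msumw F g (d : {fset K}) : (forall k, F k 0 = 0) ->
  (msupp g `<=` d)%fset -> msum F g = \sum_(k <- d) F k g@_k.
Proof.
by move=> F0 le_d; apply: big_fset_incl => // k _ /mcoeff_outdom ->; apply: F0.
Qed.

Lemma msumU F k a : (forall k, F k 0 = 0) -> msum F << a *g k >> = F k a.
Proof.
by move=> F0; rewrite (msumw F0 msuppU_le) big_seq_fset1 mcoeffUU.
Qed.

Lemma msumB F g1 g2 : (forall k, zmod_morphism (F k)) ->
  msum F (g1 - g2) = msum F g1 - msum F g2.
Proof.
move=> FB; have F0 k : F k 0 = 0 by apply: zmod_morphism0.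
rewrite (msumw F0 (msuppB_le _ _)) (msumw F0 (fsubsetUl _ (msupp g2))).
rewrite (msumw F0 (fsubsetUr (msupp g1) _)) -sumrB.
by apply: eq_bigr => k _; rewrite mcoeffB FB.
Qed.

Lemma malg_ext (f1 f2 : {malg A[K]} -> H) :
  zmod_morphism f1 -> zmod_morphism f2 ->
  (forall k a, f1 << a *g k >> = f2 << a *g k >>) -> f1 =1 f2.
Proof.
move=> f1B f2B eqf g; rewrite [g]monalgE.
rewrite (big_morph _ (zmod_morphismD f1B) (zmod_morphism0 f1B)).
rewrite (big_morph _ (zmod_morphismD f2B) (zmod_morphism0 f2B)).
by apply: eq_bigr => k _; apply: eqf.
Qed.
End FiniteSum.

(* monalg only makes {malg k[G]} a ring for k nontrivial and G a monomType,   *)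
(* where 1 is the only invertible element, so the convolution product is     *)
(* built here for an arbitrary group G.                                      *)
Definition group_ring (k : comPzRingType) (G : groupType) : Type := {malg k[G]}.

Section GroupRing.
Variables (k : comPzRingType) (G : groupType).
Local Notation kG := (group_ring k G).

HB.instance Definition _ := GRing.Zmodule.copy kG {malg k[G]}.

Definition gr_of (a : k) (x : G) : kG := << a *g x >>.

Definition gr_one : kG := gr_of 1 1%g.

Definition gr_mul (u v : kG) : kG :=
  msum (fun x a => msum (fun y b => gr_of (a * b) (x * y)%g) v) u.

Definition augmentation (u : kG) : k := msum (fun _ a => a) u.

Lemma gr_ofB x : zmod_morphism (gr_of^~ x).
Proof. by move=> a b; rewrite /gr_of monalgUB. Qed.

Lemma gr_of0 x : gr_of 0 x = 0.
Proof. exact: monalgU0. Qed.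

Let inner_addr x a : forall y, zmod_morphism (fun b => gr_of (a * b) (x * y)%g).
Proof. by move=> y b c; rewrite mulrBr gr_ofB. Qed.

Let inner_addl v x :
  zmod_morphism (fun a => msum (fun y b => gr_of (a * b) (x * y)%g) v).
Proof.
move=> a b; rewrite /msum -sumrB; apply: eq_bigr => y _.
by rewrite mulrBl gr_ofB.
Qed.

Lemma gr_mulBl v : zmod_morphism (gr_mul^~ v).
Proof. by move=> u w; apply: msumB; apply: inner_addl. Qed.

Lemma gr_mulBr u : zmod_morphism (gr_mul u).
Proof.
move=> v w; rewrite /gr_mul /msum -sumrB; apply: eq_bigr => x _.
exact: (msumB _ _ (inner_addr _ _)).
Qed.

Lemma gr_mulU a b x y :
  gr_mul (gr_of a x) (gr_of b y) = gr_of (a * b) (x * y)%g.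
Proof.
rewrite /gr_mul [LHS]msumU; last first.
  by move=> z; apply: (zmod_morphism0 (inner_addl _ _)).
by rewrite [LHS]msumU // => z; rewrite mulr0 gr_of0.
Qed.

Lemma gr_mul1 : left_id gr_one gr_mul.
Proof.
apply: malg_ext => [u v|u v|x a] //; first exact: gr_mulBr.
by rewrite [LHS]gr_mulU mul1r mul1g.
Qed.

Lemma gr_mulr1 : right_id gr_one gr_mul.
Proof.
apply: malg_ext => [u v|u v|x a] //; first exact: gr_mulBl.
by rewrite [LHS]gr_mulU mulr1 mulg1.
Qed.

Lemma gr_mulA : associative gr_mul.
Proof.
move=> u v w; move: u.
apply: malg_ext => [u u'|u u'|x a]; rewrite ?gr_mulBl //; move: v.
apply: malg_ext => [v v'|v v'|y b]; rewrite ?(gr_mulBl, gr_mulBr) //; move: w.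
apply: malg_ext => [w w'|w w'|z c]; rewrite ?(gr_mulBl, gr_mulBr) //.
by rewrite -!/(gr_of _ _) !gr_mulU mulrA mulgA.
Qed.

Lemma gr_mulDl : left_distributive gr_mul +%R.
Proof. by move=> u v w; apply: (zmod_morphismD (gr_mulBl w)). Qed.

Lemma gr_mulDr : right_distributive gr_mul +%R.
Proof. by move=> u v w; apply: (zmod_morphismD (gr_mulBr u)). Qed.

HB.instance Definition _ := GRing.Zmodule_isPzRing.Build kG
  gr_mulA gr_mul1 gr_mulr1 gr_mulDl gr_mulDr.

Lemma augmentationB : zmod_morphism augmentation.
Proof. by move=> u v; apply: msumB. Qed.

Lemma augmentationU a x : augmentation (gr_of a x) = a.
Proof. exact: msumU. Qed.

Lemma augmentation1 : augmentation 1 = 1.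
Proof. exact: augmentationU. Qed.

Lemma augmentationM : {morph augmentation : u v / u * v >-> u * v}.
Proof.
move=> u v; move: u; apply: malg_ext => [u u'|u u'|x a].
- by rewrite mulrBl augmentationB.
- by rewrite augmentationB mulrBl.
move: v; apply: malg_ext => [v v'|v v'|y b].
- by rewrite mulrBr augmentationB.
- by rewrite augmentationB mulrBr.
by rewrite -!/(gr_of _ _) [_ * _]gr_mulU !augmentationU.
Qed.
End GroupRing.

Definition trivial_module (k : comPzRingType) (G : groupType) : Type := k.

Section TrivialModule.
Variables (k : comPzRingType) (G : groupType).
Local Notation kG := (group_ring k G).
Local Notation kt := (trivial_module k G).

HB.instance Definition _ := GRing.Zmodule.copy kt k.

Definition triv_scale (u : kG) (a : kt) : kt := augmentation u * (a : k).

Lemma triv_scaleA u v a : triv_scale u (triv_scale v a) = triv_scale (u * v) a.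
Proof. by rewrite /triv_scale augmentationM mulrA. Qed.

Lemma triv_scale1 : left_id 1 triv_scale.
Proof. by move=> a; rewrite /triv_scale augmentation1 mul1r. Qed.

Lemma triv_scaleDr : right_distributive triv_scale +%R.
Proof. by move=> u a b; apply: mulrDr. Qed.

Lemma triv_scaleDl a : {morph triv_scale^~ a : u v / u + v}.
Proof.
move=> u v; rewrite /triv_scale.
by rewrite (zmod_morphismD (@augmentationB k G)); apply: mulrDl.
Qed.

HB.instance Definition _ := GRing.Zmodule_isLmodule.Build kG kt
  triv_scaleA triv_scale1 triv_scaleDr triv_scaleDl.
End TrivialModule.

Section TensorProduct.
Context {R : pzRingType} (N : lmodType R^c) (M : lmodType R).
Local Notation free := {malg int[(N * M)%type]}.

(* The subgroup of the free abelian group on N * M generated by the           *)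
(* bilinearity and balancing relators. A right R-module is a left module over *)
(* the converse ring R^c: (r : R^c) *: x is x acted on by r from the right.   *)
Inductive tensor_rel : free -> Prop :=
| tensor_rel0 : tensor_rel 0
| tensor_relB s t : tensor_rel s -> tensor_rel t -> tensor_rel (s - t)
| tensor_relDl x x' y :
    tensor_rel (<< (x + x', y) >> - << (x, y) >> - << (x', y) >>)
| tensor_relDr x y y' :
    tensor_rel (<< (x, y + y') >> - << (x, y) >> - << (x, y') >>)
| tensor_relZ x (r : R) y :
    tensor_rel (<< ((r : R^c) *: x, y) >> - << (x, r *: y) >>).

Definition tensor_relb : pred free := fun t => `[< tensor_rel t >].

Lemma tensor_relb_zmod_closed : zmod_closed tensor_relb.
Proof.
split; first by apply/asboolP; apply: tensor_rel0.
by move=> s t /asboolP rs /asboolP rt; apply/asboolP/tensor_relB.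
Qed.

HB.instance Definition _ :=
  GRing.isZmodClosed.Build free tensor_relb tensor_relb_zmod_closed.

Definition tensor_relations : zmodClosed free :=
  GRing.ZmodClosed.clone free tensor_relb _.

Definition tensor : Type := Quotient.quot tensor_relations.
HB.instance Definition _ := GRing.Zmodule.on tensor.

Definition tensor_class (t : free) : tensor := \pi_(Quotient.quot tensor_relations)%qT t.

Definition pure_tensor (x : N) (y : M) : tensor := tensor_class << (x, y) >>.

Lemma tensor_classB : zmod_morphism tensor_class.
Proof. by move=> s t; apply: pi_is_zmod_morphism. Qed.

Lemma tensor_class_eq s t : tensor_class s = tensor_class t <-> tensor_rel (s - t).
Proof.
split=> [/eqP|rst]; first by rewrite -Quotient.idealrBE => /asboolP.
by apply/eqP; rewrite -Quotient.idealrBE; apply/asboolP.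
Qed.

Lemma tensor_class_repr (t : tensor) : tensor_class (repr t) = t.
Proof. exact: reprK. Qed.
End TensorProduct.

Arguments tensor {R} N M.

Section TensorMap.
Context {R : pzRingType} {N N' : lmodType R^c} {M M' : lmodType R}.
Variables (f : {linear N -> N'}) (g : {linear M -> M'}).

Definition free_map (t : {malg int[(N * M)%type]}) : {malg int[(N' * M')%type]} :=
  msum (fun p n => << n *g (f p.1, g p.2) >>) t.

Definition tensor_map (t : tensor N M) : tensor N' M' :=
  tensor_class (free_map (repr t)).

Lemma free_mapB : zmod_morphism free_map.
Proof. by move=> s t; apply: msumB => p m n; rewrite monalgUB. Qed.

Lemma free_mapU p n : free_map << n *g p >> = << n *g (f p.1, g p.2) >>.
Proof. by apply: msumU => q; rewrite monalgU0. Qed.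

Lemma free_map_rel t : tensor_rel t -> tensor_rel (free_map t).
Proof.
elim=> {t} [|s t _ rs _ rt|x x' y|x y y'|x r y].
- by rewrite -(subrr 0) free_mapB subrr; apply: tensor_rel0.
- by rewrite free_mapB; apply: tensor_relB.
- by rewrite !free_mapB !free_mapU /= linearD; apply: tensor_relDl.
- by rewrite !free_mapB !free_mapU /= linearD; apply: tensor_relDr.
- by rewrite !free_mapB !free_mapU /= !linearZ; apply: tensor_relZ.
Qed.

Lemma tensor_map_class t : tensor_map (tensor_class t) = tensor_class (free_map t).
Proof.
apply/tensor_class_eq; rewrite -free_mapB; apply: free_map_rel.
by apply/tensor_class_eq; apply: tensor_class_repr.
Qed.

Lemma tensor_map_pure x y : tensor_map (pure_tensor x y) = pure_tensor (f x) (g y).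
Proof. by rewrite tensor_map_class free_mapU. Qed.

Lemma tensor_mapB : zmod_morphism tensor_map.
Proof.
move=> s t; rewrite -[s]tensor_class_repr -[t]tensor_class_repr.
by rewrite -tensor_classB !tensor_map_class free_mapB tensor_classB.
Qed.
End TensorMap.

Definition surjective {A B : Type} (f : A -> B) : Prop := forall b, exists a, f a = b.

Definition projective_module (R : pzRingType) (P : lmodType R) : Prop :=
  forall (A B : lmodType R) (p : {linear A -> B}) (f : {linear P -> B}),
    surjective p -> exists g : {linear P -> A}, forall x, p (g x) = f x.

Definition injective_module (R : pzRingType) (I : lmodType R) : Prop :=
  forall (A B : lmodType R) (i : {linear A -> B}) (f : {linear A -> I}),
    injective i -> exists g : {linear B -> I}, forall x, g (i x) = f x.

Definition flat_module (R : pzRingType) (F : lmodType R) : Prop :=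
  forall (N N' : lmodType R^c) (i : {linear N -> N'}),
    injective i -> injective (tensor_map i (idfun : {linear F -> F})).

Definition is_exact {A B : Type} {C : zmodType} (f : A -> B) (g : B -> C) : Prop :=
  forall y, g y = 0 <-> exists x, f x = y.

Record complex (R : pzRingType) := Complex {
  cobj :> int -> lmodType R;
  cdiff : forall n : int, {linear cobj (n + 1) -> cobj n};
  cdiffK : forall (n : int) x, cdiff n (cdiff (n + 1) x) = 0
}.

Definition acyclic (R : pzRingType) (C : complex R) : Prop :=
  forall n : int, is_exact (cdiff C (n + 1)) (cdiff C n).

(* Exactness of Hom(C_n, Q) -> Hom(C_(n+1), Q) -> Hom(C_(n+2), Q), for all n. *)
Definition hom_acyclic (R : pzRingType) (C : complex R) (Q : lmodType R) : Prop :=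
  forall (n : int) (f : {linear C (n + 1) -> Q}),
    (forall x, f (cdiff C (n + 1) x) = 0) <->
    (exists g : {linear C n -> Q}, forall x, g (cdiff C n x) = f x).

Definition tensor_acyclic (R : pzRingType) (I : lmodType R^c) (C : complex R) : Prop :=
  forall n : int,
    is_exact (tensor_map (idfun : {linear I -> I}) (cdiff C (n + 1)))
          (tensor_map (idfun : {linear I -> I}) (cdiff C n)).

Record resolution (R : pzRingType) (X : lmodType R -> Prop) (M : lmodType R) :=
  Resolution {
    robj :> nat -> lmodType R;
    rdiff : forall n : nat, {linear robj n.+1 -> robj n};
    raug : {linear robj 0%N -> M};
    robjP : forall n, X (robj n);
    raug_surj : surjective raug;
    raug_exact : is_exact (rdiff 0%N) raug;
    rdiff_exact : forall n, is_exact (rdiff n.+1) (rdiff n)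
  }.

Definition length_le (R : pzRingType) (X : lmodType R -> Prop) (M : lmodType R)
    (r : resolution X M) (n : nat) : Prop :=
  forall i : nat, (n < i)%N -> forall x : r i, x = 0.

Definition resolution_dim (R : pzRingType) (X : lmodType R -> Prop)
    (M : lmodType R) : enat :=
  least (fun n => exists r : resolution X M, length_le r n).

Definition flat_dim (R : pzRingType) (M : lmodType R) : enat :=
  resolution_dim (@flat_module R) M.

Definition sfli (R : pzRingType) : enat :=
  esup (fun d => exists2 I : lmodType R, injective_module I & d = flat_dim I).

(* M is isomorphic to the kernel of a differential of C. *)
Definition syzygy (R : pzRingType) (C : complex R) (M : lmodType R) : Prop :=
  exists (n : int) (i : {linear M -> C (n + 1)}), injective i /\ is_exact i (cdiff C n).

Definition complete_projective_resolution (R : pzRingType) (P : complex R) : Prop :=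
  [/\ acyclic P, forall n, projective_module (P n) &
      forall Q : lmodType R, projective_module Q -> hom_acyclic P Q].

Definition complete_flat_resolution (R : pzRingType) (F : complex R) : Prop :=
  [/\ acyclic F, forall n, flat_module (F n) &
      forall I : lmodType R^c, injective_module I -> tensor_acyclic I F].

Definition gorenstein_projective (R : pzRingType) (M : lmodType R) : Prop :=
  exists2 P : complex R, complete_projective_resolution P & syzygy P M.

Definition gorenstein_flat (R : pzRingType) (M : lmodType R) : Prop :=
  exists2 F : complex R, complete_flat_resolution F & syzygy F M.

Definition Gpd (R : pzRingType) (M : lmodType R) : enat :=
  resolution_dim (@gorenstein_projective R) M.

Definition Gfd (R : pzRingType) (M : lmodType R) : enat :=
  resolution_dim (@gorenstein_flat R) M.

Definition Gcd (k : comPzRingType) (G : groupType) : enat :=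
  Gpd (trivial_module k G : lmodType (group_ring k G)).

Definition Ghd (k : comPzRingType) (G : groupType) : enat :=
  Gfd (trivial_module k G : lmodType (group_ring k G)).

(* Main.v *)
Require Import Defs.
From HB Require Import structures.
From mathcomp Require Import all_boot all_algebra.
From mathcomp Require Import finmap boolp monalg.

Set Implicit Arguments.
Unset Strict Implicit.
Unset Printing Implicit Defensive.

Import GRing.Theory.

Local Open Scope ring_scope.

(** Write R for the group ring kG and suppose that the trivial module k has a
    finite resolution by Gorenstein projective R-modules. The proof shows that
    then every complete projective resolution over R is a complete flat
    resolution: it stays exact after tensoring with an injective right R-module
    I ([complete_projective_flat]). So every Gorenstein projective module is
    Gorenstein flat, and the given resolution of k also bounds its Gorenstein
    flat dimension.

    The restriction of I to k is injective ([right_restrict_injective]), so it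
    has a finite flat resolution over k, because sfli k is finite. Gorenstein
    projective R-modules are syzygies of projective modules in every degree, so
    their Tor groups over k against I vanish, by dimension shifting past the
    length of this resolution ([gorenstein_projective_tor_acyclic]). Hence the
    diagonal tensor product over k with I is exact on short exact sequences that
    end in such a module ([diag_map_inj]).

    Since k has finite Gorenstein projective dimension, it embeds into a module A
    of finite projective dimension with cokernel an iterated extension of
    Gorenstein projective modules ([hull_exists]). The diagonal tensor product
    of A and I contains I, and I is a direct summand of it because I is
    injective. It therefore suffices to prove that tensoring over R with this
    product preserves the inclusion of a syzygy L into a projective module.

    For A projective this holds because the tensor product over R of A (x) I with
    L equals that of L (x) I with A ([diag_swap_inj]): the diagonal tensor product
    with I preserves the inclusion of L, and A is flat over R. The general case
    follows by dimension shifting along the finite projective resolution of A,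
    against the infinite sequence of cosyzygies of L ([syzygy_pure_cokernel]).
    The purity of A is established along the inductive construction of A rather
    than from a resolution of it. *)

(** * Linear maps, kernels, cokernels, products *)

Definition to_linear (R : pzRingType) (U V : lmodType R) (f : U -> V)
    (fL : linear f) : {linear U -> V} :=
  HB.pack f (GRing.isLinear.Build R U V *:%R f fL).

Lemma to_linearE (R : pzRingType) (U V : lmodType R) (f : U -> V)
    (fL : linear f) x : to_linear fL x = f x.
Proof. by []. Qed.

Lemma inj_ker0 (U V : zmodType) (f : U -> V) :
  zmod_morphism f -> (forall x, f x = 0 -> x = 0) -> injective f.
Proof.
move=> fB f0 x y exy; apply/eqP; rewrite -subr_eq0; apply/eqP/f0.
by rewrite fB exy subrr.
Qed.

Lemma inj_eq0 (U V : zmodType) (f : U -> V) x :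
  zmod_morphism f -> injective f -> f x = 0 -> x = 0.
Proof. by move=> fB fI fx; apply: fI; rewrite fx (zmod_morphism0 fB). Qed.

Section Module.
Variable R : pzRingType.
Implicit Types U V W : lmodType R.

Lemma linear_zmod U V (f : {linear U -> V}) : zmod_morphism f.
Proof. by move=> x y; rewrite linearB. Qed.

Lemma linear_inj U V (f : {linear U -> V}) :
  (forall x, f x = 0 -> x = 0) -> injective f.
Proof. exact/inj_ker0/linear_zmod. Qed.

Lemma linear_eq0 U V (f : {linear U -> V}) x : injective f -> f x = 0 -> x = 0.
Proof. exact/inj_eq0/linear_zmod. Qed.

Lemma exact_comp0 U V W (f : {linear U -> V}) (g : {linear V -> W}) x :
  is_exact f g -> g (f x) = 0.
Proof. by move=> ex; apply/ex; exists x. Qed.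

(** Quotients enter below only as surjections with a prescribed kernel, and
    this universal property is the only way in which maps out of them are made. *)
Lemma surj_factor U V W (p : {linear U -> V}) (f : {linear U -> W}) :
  surjective p -> (forall x, p x = 0 -> f x = 0) ->
  exists g : {linear V -> W}, forall x, g (p x) = f x.
Proof.
move=> /choice[s sK] pf.
have fs x : f (s (p x)) = f x.
  by apply/eqP; rewrite -subr_eq0 -linearB; apply/eqP/pf; rewrite linearB sK subrr.
have gL : linear (f \o s).
  move=> a x y /=; rewrite -linearP -[RHS]fs; congr (f (s _)).
  by rewrite linearP !sK.
by exists (to_linear gL).
Qed.

Lemma inj_factor U V W (i : {linear V -> W}) (f : {linear U -> W}) :
  injective i -> (forall x, exists y, i y = f x) ->
  exists g : {linear U -> V}, forall x, i (g x) = f x.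
Proof.
move=> iI /choice[g gK].
have gL : linear g by move=> a x y; apply: iI; rewrite linearP !gK linearP.
by exists (to_linear gL).
Qed.

Definition in_kernel U V (f : {linear U -> V}) : pred U := fun x => f x == 0.

Lemma in_kernel_closed U V (f : {linear U -> V}) : submod_closed (in_kernel f).
Proof.
split; first by rewrite unfold_in linear0.
by move=> a x y; rewrite !unfold_in => /eqP fx /eqP fy; rewrite linearP fx fy scaler0 addr0.
Qed.

HB.instance Definition _ U V (f : {linear U -> V}) :=
  GRing.isSubmodClosed.Build R U (in_kernel f) (in_kernel_closed f).

Definition kernel U V (f : {linear U -> V}) : Type := {x | x \in in_kernel f}.
HB.instance Definition _ U V (f : {linear U -> V}) := SubChoice.on (kernel f).
HB.instance Definition _ U V (f : {linear U -> V}) :=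
  [SubChoice_isSubLmodule of kernel f by <:].

Lemma kernel_exists U V (f : {linear U -> V}) :
  exists (K : lmodType R) (i : {linear K -> U}), injective i /\ is_exact i f.
Proof.
exists (kernel f), (\val : {linear kernel f -> U}); split; first exact: val_inj.
move=> y; split=> [fy|[[x fx] <-]]; last by apply/eqP.
have yK : y \in in_kernel f by apply/eqP; exact: fy.
by exists (exist _ y yK).
Qed.
End Module.

Section Quotient.
Variables (V : zmodType) (S : V -> Prop).
Hypothesis S0 : S 0.
Hypothesis SB : forall x y, S x -> S y -> S (x - y).

Definition subgroup_pred (_ : S 0) (_ : forall x y, S x -> S y -> S (x - y)) : pred V :=
  fun x => `[< S x >].

Lemma subgroup_pred_closed : zmod_closed (subgroup_pred S0 SB).
Proof.
by split=> [|x y /asboolP Sx /asboolP Sy]; apply/asboolP=> //; apply: SB.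
Qed.

HB.instance Definition _ :=
  GRing.isZmodClosed.Build V (subgroup_pred S0 SB) subgroup_pred_closed.

Lemma quotient_exists : exists (W : zmodType) (p : V -> W),
  [/\ zmod_morphism p, surjective p & forall x, p x = 0 <-> S x].
Proof.
pose I := GRing.ZmodClosed.clone V (subgroup_pred S0 SB) _.
exists (Quotient.quot I), \pi_(Quotient.quot I)%qT.
split; first exact: pi_is_zmod_morphism.
  by move=> y; exists (repr y); rewrite reprK.
move=> x; split=> [px|Sx].
  apply/asboolP; rewrite -[x]subr0.
  apply: etrans (Quotient.idealrBE I x 0) _.
  by apply/eqP; rewrite px [RHS]raddf0.
apply/eqP; rewrite -[0](raddf0 \pi_(Quotient.quot I)%qT) -Quotient.idealrBE subr0.
exact/asboolP.
Qed.
End Quotient.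

Lemma zmod_cokernel_exists (U V : zmodType) (f : U -> V) : zmod_morphism f ->
  exists (W : zmodType) (p : V -> W),
  [/\ zmod_morphism p, surjective p & is_exact f p].
Proof.
move=> fB; apply: (quotient_exists (S := fun y => exists x, f x = y)).
  by exists 0; apply: zmod_morphism0.
by move=> _ _ [x <-] [y <-]; exists (x - y).
Qed.

Section QuotientModule.
Variables (R : pzRingType) (V : lmodType R) (W : zmodType) (p : V -> W).
Hypotheses (pB : zmod_morphism p) (pS : surjective p).
Hypothesis pZ : forall a x, p x = 0 -> p (a *: x) = 0.

Definition quotient_module (_ : zmod_morphism p) (_ : surjective p)
  (_ : forall a x, p x = 0 -> p (a *: x) = 0) : Type := W.
Local Notation Q := (quotient_module pB pS pZ).
HB.instance Definition _ := GRing.Zmodule.copy Q W.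

Definition quotient_scale (a : R) (y : Q) : Q := p (a *: projT1 (cid (pS y))).

Lemma quotient_scaleE a x : quotient_scale a (p x) = p (a *: x).
Proof.
rewrite /quotient_scale; case: cid => z /= pz.
apply/eqP; rewrite -subr_eq0 -(pB (a *: z)) -scalerBr; apply/eqP/pZ.
by rewrite pB pz subrr.
Qed.

Lemma quotient_scaleA a b y :
  quotient_scale a (quotient_scale b y) = quotient_scale (a * b) y.
Proof. by case: (pS y) => x <-; rewrite !quotient_scaleE scalerA. Qed.

Lemma quotient_scale1 : left_id 1 quotient_scale.
Proof. by move=> y; case: (pS y) => x <-; rewrite quotient_scaleE scale1r. Qed.

Lemma quotient_scaleDr : right_distributive quotient_scale +%R.
Proof.
move=> a y z; case: (pS y) => x <-; case: (pS z) => x' <-.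
rewrite -[_ + _](zmod_morphismD pB) !quotient_scaleE scalerDr.
exact: zmod_morphismD.
Qed.

Lemma quotient_scaleDl y : {morph quotient_scale^~ y : a b / a + b}.
Proof.
move=> a b; case: (pS y) => x <-; rewrite !quotient_scaleE scalerDl.
exact: zmod_morphismD.
Qed.

HB.instance Definition _ := GRing.Zmodule_isLmodule.Build R Q
  quotient_scaleA quotient_scale1 quotient_scaleDr quotient_scaleDl.

Lemma quotient_linear : linear (p : V -> Q).
Proof.
move=> a x y; rewrite (zmod_morphismD pB); congr (_ + _).
by rewrite -quotient_scaleE.
Qed.
End QuotientModule.

Section Module2.
Variable R : pzRingType.
Implicit Types U V W : lmodType R.

Lemma cokernel_exists U V (f : {linear U -> V}) :
  exists (W : lmodType R) (p : {linear V -> W}), surjective p /\ is_exact f p.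
Proof.
have [W [p [pB pS ex]]] := zmod_cokernel_exists (linear_zmod f).
have pZ a x : p x = 0 -> p (a *: x) = 0.
  by move=> /ex[y <-]; apply/ex; exists (a *: y); rewrite linearZ.
exists (quotient_module pB pS pZ), (to_linear (quotient_linear pB pS pZ)).
by split.
Qed.

Definition pair_map U V W (f : {linear U -> V}) (g : {linear U -> W}) :
  U -> (V * W)%type := fun x => (f x, g x).
Lemma pair_map_linear U V W (f : {linear U -> V}) (g : {linear U -> W}) :
  linear (pair_map f g).
Proof. by move=> a x y; rewrite /pair_map !linearP. Qed.
HB.instance Definition _ U V W (f : {linear U -> V}) (g : {linear U -> W}) :=
  GRing.isLinear.Build R U (V * W)%type *:%R (pair_map f g) (pair_map_linear f g).

Definition sum_map U V W (f : {linear U -> W}) (g : {linear V -> W}) :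
  (U * V)%type -> W := fun x => f x.1 + g x.2.
Lemma sum_map_linear U V W (f : {linear U -> W}) (g : {linear V -> W}) :
  linear (sum_map f g).
Proof. by move=> a x y; rewrite /sum_map /= !linearP scalerDr addrACA. Qed.
HB.instance Definition _ U V W (f : {linear U -> W}) (g : {linear V -> W}) :=
  GRing.isLinear.Build R (U * V)%type W *:%R (sum_map f g) (sum_map_linear f g).

Lemma pair_projective U V :
  projective_module U -> projective_module V -> projective_module (U * V)%type.
Proof.
move=> pU pV A B p f pS.
have [g gE] := pU _ _ p (f \o pair_map idfun \0) pS.
have [h hE] := pV _ _ p (f \o pair_map \0 idfun) pS.
exists (sum_map g h) => -[u v]; rewrite linearD gE hE /= -linearD /pair_map /=.
by congr (f (_, _)); rewrite ?addr0 ?add0r.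
Qed.
End Module2.

(** * Tensor products *)

Lemma zmod_morphism_sub (U V : zmodType) (f g : U -> V) :
  zmod_morphism f -> zmod_morphism g -> zmod_morphism (fun x => f x - g x).
Proof. by move=> fB gB x y; rewrite fB gB opprD addrACA opprD addrACA. Qed.

Lemma zmod_comp (U V W : zmodType) (f : U -> V) (g : V -> W) :
  zmod_morphism f -> zmod_morphism g -> zmod_morphism (g \o f).
Proof. by move=> fB gB x y; rewrite /= fB gB. Qed.

Lemma zmod_morphismMz (U V : zmodType) (f : U -> V) (n : int) :
  zmod_morphism f -> {morph f : x / x *~ n}.
Proof.
move=> fB; pose g : {additive U -> V} := HB.pack f (GRing.isZmodMorphism.Build U V f fB).
by move=> x; apply: (raddfMz g).
Qed.

Section Tensor.
Context {R : pzRingType} (N : lmodType R^c) (M : lmodType R).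
Implicit Types (W : zmodType).

Lemma tensor_class_eq0 (t : {malg int[(N * M)%type]}) :
  tensor_rel t -> tensor_class t = 0.
Proof.
move=> rt; rewrite -(zmod_morphism0 (@tensor_classB R N M)).
by apply/tensor_class_eq; rewrite subr0.
Qed.

Lemma pure_tensorBr (x : N) : zmod_morphism (@pure_tensor R N M x).
Proof.
have D (y y' : M) : pure_tensor x (y + y') = pure_tensor x y + pure_tensor x y'.
  apply/eqP; rewrite -subr_eq0 opprD addrA; apply/eqP.
  by rewrite /pure_tensor -!tensor_classB; apply/tensor_class_eq0/tensor_relDr.
by move=> y y'; rewrite -{2}[y](subrK y') (D (y - y')) addrK.
Qed.

Lemma pure_tensorBl (y : M) : zmod_morphism (fun x : N => pure_tensor x y).
Proof.
have D (x x' : N) : pure_tensor (x + x') y = pure_tensor x y + pure_tensor x' y.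
  apply/eqP; rewrite -subr_eq0 opprD addrA; apply/eqP.
  by rewrite /pure_tensor -!tensor_classB; apply/tensor_class_eq0/tensor_relDl.
by move=> x x'; rewrite -{2}[x](subrK x') (D (x - x')) addrK.
Qed.

Lemma pure_tensorZ (r : R) (x : N) (y : M) :
  pure_tensor ((r : R^c) *: x) y = pure_tensor x (r *: y).
Proof. by apply/tensor_class_eq; apply: tensor_relZ. Qed.

Lemma tensor_ext W (f g : tensor N M -> W) :
  zmod_morphism f -> zmod_morphism g ->
  (forall x y, f (pure_tensor x y) = g (pure_tensor x y)) -> f =1 g.
Proof.
move=> fB gB efg t; rewrite -[t]tensor_class_repr.
move: (repr t); apply: malg_ext.
- exact: (zmod_comp (@tensor_classB R N M) fB).
- exact: (zmod_comp (@tensor_classB R N M) gB).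
case=> x y n; have -> : << n *g (x, y) >> = << (x, y) >> *~ n :> {malg int[(N * M)%type]}.
  by rewrite -(raddfMz (mkmalgU (x, y))) intz.
by rewrite !(zmod_morphismMz n (@tensor_classB R N M)) !zmod_morphismMz // efg.
Qed.

Section Lift.
Variables (W : zmodType) (b : N -> M -> W).
Hypotheses (bBr : forall x, zmod_morphism (b x)) (bBl : forall y, zmod_morphism (b^~ y)).
Hypothesis bZ : forall (r : R) x y, b ((r : R^c) *: x) y = b x (r *: y).

Lemma tensor_lift_exists : exists f : tensor N M -> W,
  zmod_morphism f /\ forall x y, f (pure_tensor x y) = b x y.
Proof.
pose h (t : {malg int[(N * M)%type]}) := msum (fun p n => b p.1 p.2 *~ n) t.
have hB : zmod_morphism h by move=> s t; apply: msumB => p m n; rewrite mulrzBr.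
have hU x y : h << (x, y) >> = b x y by rewrite [LHS]msumU.
have h0 t : tensor_rel t -> h t = 0.
  elim=> {t} [|s t _ hs _ ht|x x' y|x y y'|x r y].
  - exact: zmod_morphism0.
  - by rewrite hB hs ht subrr.
  - by rewrite !hB !hU (zmod_morphismD (bBl y)) /= addrAC addrK subrr.
  - by rewrite !hB !hU (zmod_morphismD (bBr x)) addrAC addrK subrr.
  - by rewrite !hB !hU bZ subrr.
have hE t : h (repr (tensor_class t)) = h t.
  apply/eqP; rewrite -subr_eq0 -hB; apply/eqP/h0/tensor_class_eq.
  exact: tensor_class_repr.
exists (fun t => h (repr t)); split; last by move=> x y; rewrite hE.
move=> s t; rewrite -[s]tensor_class_repr -[t]tensor_class_repr.
by rewrite -tensor_classB !hE hB.
Qed.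

Definition tensor_lift : tensor N M -> W := projT1 (cid tensor_lift_exists).
Lemma tensor_liftB : zmod_morphism tensor_lift.
Proof. by rewrite /tensor_lift; case: cid => f []. Qed.
Lemma tensor_liftE x y : tensor_lift (pure_tensor x y) = b x y.
Proof. by rewrite /tensor_lift; case: cid => f []. Qed.
End Lift.
End Tensor.

(** Right exactness in either factor is the case where the other map is the
    identity and h is the projection onto a cokernel. The induced map is defined
    on pure tensors by lifting both factors. *)
Lemma tensor_descend (R : pzRingType) (N N' : lmodType R^c) (M M' : lmodType R)
    (f : {linear N -> N'}) (g : {linear M -> M'}) (W : zmodType)
    (h : tensor N M -> W) :
  surjective f -> surjective g -> zmod_morphism h ->
  (forall x y, f x = 0 -> h (pure_tensor x y) = 0) ->
  (forall x y, g y = 0 -> h (pure_tensor x y) = 0) ->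
  exists h' : tensor N' M' -> W, zmod_morphism h' /\
    forall t, h' (tensor_map f g t) = h t.
Proof.
move=> /choice[s sK] /choice[s' s'K] hB hf hg.
have hl x x' y : f x = f x' -> h (pure_tensor x y) = h (pure_tensor x' y).
  move=> e; apply/eqP; rewrite -subr_eq0 -hB -pure_tensorBl; apply/eqP/hf.
  by rewrite linearB e subrr.
have hr x y y' : g y = g y' -> h (pure_tensor x y) = h (pure_tensor x y').
  move=> e; apply/eqP; rewrite -subr_eq0 -hB -pure_tensorBr; apply/eqP/hg.
  by rewrite linearB e subrr.
pose b x y := h (pure_tensor (s x) (s' y)).
have bBr x : zmod_morphism (b x).
  by move=> y y'; rewrite /b -hB -pure_tensorBr; apply: hr; rewrite linearB !s'K.
have bBl y : zmod_morphism (b^~ y).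
  by move=> x x'; rewrite /b -hB -pure_tensorBl; apply: hl; rewrite linearB !sK.
have bZ (r : R) x y : b ((r : R^c) *: x) y = b x (r *: y).
  rewrite /b (hl _ ((r : R^c) *: s x)); last by rewrite linearZ /= !sK.
  by rewrite pure_tensorZ; apply: hr; rewrite linearZ /= !s'K.
exists (tensor_lift bBr bBl bZ); split; first exact: tensor_liftB.
apply: tensor_ext => // [|x y].
  by apply: (zmod_comp (f := tensor_map f g)); [apply: tensor_mapB|apply: tensor_liftB].
by rewrite tensor_map_pure tensor_liftE /b (hl _ x) ?sK //; apply: hr.
Qed.

Section RightExact.
Variable R : pzRingType.
Implicit Types (N : lmodType R^c) (M : lmodType R).

Lemma tensor_map_surj N N' M M' (f : {linear N -> N'}) (g : {linear M -> M'}) :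
  surjective f -> surjective g -> surjective (tensor_map f g).
Proof.
move=> fS gS; have mB := @tensor_mapB _ _ _ _ _ f g.
have [W [p [pB pS ex]]] := zmod_cokernel_exists mB.
have p0 : p =1 (fun=> 0).
  apply: tensor_ext => // [x y|x y]; first by rewrite subrr.
  case: (fS x) (gS y) => x' <- [y' <-]; apply/ex.
  by exists (pure_tensor x' y'); rewrite tensor_map_pure.
by move=> t; apply/ex/p0.
Qed.

Lemma tensor_map_id N M (f : {linear N -> N}) (g : {linear M -> M}) :
  f =1 idfun -> g =1 idfun -> tensor_map f g =1 idfun.
Proof.
move=> f1 g1; apply: tensor_ext => // [|x y]; first exact: tensor_mapB.
by rewrite tensor_map_pure f1 g1.
Qed.

Lemma tensor_map_comp N N' N'' M M' M''
    (f : {linear N -> N'}) (f' : {linear N' -> N''})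
    (g : {linear M -> M'}) (g' : {linear M' -> M''})
    (f'' : {linear N -> N''}) (g'' : {linear M -> M''}) :
  f' \o f =1 f'' -> g' \o g =1 g'' ->
  forall t, tensor_map f' g' (tensor_map f g t) = tensor_map f'' g'' t.
Proof.
move=> ef eg; apply: tensor_ext => [||x y].
- by apply: (zmod_comp (f := tensor_map f g)); apply: tensor_mapB.
- exact: tensor_mapB.
- by rewrite !tensor_map_pure -ef -eg.
Qed.

Lemma tensor_map0 N N' M M' (f : {linear N -> N'}) (g : {linear M -> M'}) :
  (forall x, f x = 0) \/ (forall y, g y = 0) ->
  forall t, tensor_map f g t = 0.
Proof.
move=> fg; apply: tensor_ext => // [|x y|x y]; first exact: tensor_mapB.
  by rewrite subrr.
rewrite tensor_map_pure; case: fg => ->.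
  exact: (zmod_morphism0 (@pure_tensorBl _ _ _ _)).
exact: (zmod_morphism0 (@pure_tensorBr _ _ _ _)).
Qed.

Lemma tensor_exactr N M M' M'' (f : {linear M -> M'}) (g : {linear M' -> M''}) :
  is_exact f g -> surjective g ->
  is_exact (tensor_map (idfun : {linear N -> N}) f)
           (tensor_map (idfun : {linear N -> N}) g).
Proof.
move=> ex gS t; split=> [gt|[s <-]]; last first.
  rewrite (tensor_map_comp (f'' := idfun) (g'' := \0)) //.
    by apply: tensor_map0; right.
  by move=> x; apply: exact_comp0 ex.
have [W [p [pB pS pe]]] :=
  zmod_cokernel_exists (@tensor_mapB _ _ _ _ _ (idfun : {linear N -> N}) f).
have idS : surjective (idfun : {linear N -> N}) by move=> x; exists x.
have [||h [hB hE]] := tensor_descend idS gS pB; last first.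
- by apply/pe; rewrite -hE gt; apply: zmod_morphism0.
- move=> x y /ex[z <-]; apply/pe; exists (pure_tensor x z).
  by rewrite tensor_map_pure.
- move=> x y /= ->; rewrite (zmod_morphism0 (@pure_tensorBl _ _ _ y)).
  exact: zmod_morphism0.
Qed.

Lemma tensor_exactl N N' N'' M (f : {linear N -> N'}) (g : {linear N' -> N''}) :
  is_exact f g -> surjective g ->
  is_exact (tensor_map f (idfun : {linear M -> M}))
           (tensor_map g (idfun : {linear M -> M})).
Proof.
move=> ex gS t; split=> [gt|[s <-]]; last first.
  rewrite (tensor_map_comp (g'' := idfun) (f'' := \0)) //.
    by apply: tensor_map0; left.
  by move=> x; apply: exact_comp0 ex.
have [W [p [pB pS pe]]] :=
  zmod_cokernel_exists (@tensor_mapB _ _ _ _ _ f (idfun : {linear M -> M})).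
have idS : surjective (idfun : {linear M -> M}) by move=> x; exists x.
have [||h [hB hE]] := tensor_descend gS idS pB; last first.
- by apply/pe; rewrite -hE gt; apply: zmod_morphism0.
- move=> x y /= ->; rewrite (zmod_morphism0 (@pure_tensorBr _ _ _ x)).
  exact: zmod_morphism0.
- move=> x y /ex[z <-]; apply/pe; exists (pure_tensor z y).
  by rewrite tensor_map_pure.
Qed.
End RightExact.

(** * Diagram chases *)

(** A, B and C form a short exact sequence of complexes, seen in two consecutive
    degrees. The image of s in B is the boundary of u; the last hypothesis corrects u by a cycle w so that it comes
    from A. When C is acyclic w is a boundary, and when C has injective
    differential w is zero; both cases occur. *)
Lemma boundary_reflect (A2 A1 B2 B1 C2 C1 : zmodType)
    (i2 : A2 -> B2) (p2 : B2 -> C2) (i1 : A1 -> B1) (p1 : B1 -> C1)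
    (dA : A2 -> A1) (dB : B2 -> B1) (dC : C2 -> C1) :
  zmod_morphism p2 -> zmod_morphism dB ->
  is_exact i2 p2 -> injective i1 -> (forall x, p1 (i1 x) = 0) ->
  (forall x, i1 (dA x) = dB (i2 x)) -> (forall x, p1 (dB x) = dC (p2 x)) ->
  (forall c, dC c = 0 -> exists2 w, p2 w = c & dB w = 0) ->
  forall s u, i1 s = dB u -> exists l, dA l = s.
Proof.
move=> p2B dBB ex i1I pi1 sqi sqp lift s u e.
have [|w pw dw] := lift (p2 u); first by rewrite -sqp -e pi1.
have [l il] : exists l, i2 l = u - w by apply/ex; rewrite p2B pw subrr.
by exists l; apply: i1I; rewrite sqi il dBB dw subr0 e.
Qed.

(** The long exact homology sequence of a short exact sequence of complexes, at
    the middle complex. *)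
Lemma exact_middle (A0 A1 A2 B0 B1 B2 C0 C1 C2 : zmodType)
    (i0 : A0 -> B0) (i1 : A1 -> B1) (p1 : B1 -> C1)
    (i2 : A2 -> B2) (p2 : B2 -> C2) (p0 : B0 -> C0)
    (dA1 : A1 -> A0) (dA2 : A2 -> A1) (dB1 : B1 -> B0) (dB2 : B2 -> B1)
    (dC1 : C1 -> C0) (dC2 : C2 -> C1) :
  zmod_morphism dB1 -> zmod_morphism dB2 -> zmod_morphism p1 -> zmod_morphism p0 ->
  injective i0 -> i0 0 = 0 -> is_exact i1 p1 -> surjective p2 ->
  (forall x, i0 (dA1 x) = dB1 (i1 x)) -> (forall x, i1 (dA2 x) = dB2 (i2 x)) ->
  (forall x, p0 (dB1 x) = dC1 (p1 x)) -> (forall x, p1 (dB2 x) = dC2 (p2 x)) ->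
  (forall x, dB1 (dB2 x) = 0) ->
  is_exact dA2 dA1 -> is_exact dC2 dC1 -> is_exact dB2 dB1.
Proof.
move=> dB1B dB2B p1B p0B i0I i00 ex p2S sqi1 sqi2 sqp1 sqp2 dd exA exC t.
split=> [dt|[u <-]]; last exact: dd.
have [c dc] : exists c, dC2 c = p1 t.
  by apply/exC; rewrite -sqp1 dt (zmod_morphism0 p0B).
have [b pb] := p2S c.
have [a ia] : exists a, i1 a = t - dB2 b.
  by apply/ex; rewrite p1B sqp2 pb dc subrr.
have [l dl] : exists l, dA2 l = a.
  by apply/exA/i0I; rewrite sqi1 ia dB1B dt dd subrr i00.
exists (b + i2 l); rewrite (zmod_morphismD dB2B) -sqi2 dl ia.
by rewrite addrC subrK.
Qed.

(** * Flatness of projective modules *)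

Section Coordinates.
Variable X : choiceType.

Definition malg_map (A B : zmodType) (i : A -> B) (g : {malg A[X]}) : {malg B[X]} :=
  msum (fun q a => << i a *g q >>) g.

Lemma malg_mapB (A B : zmodType) (i : A -> B) :
  zmod_morphism i -> zmod_morphism (malg_map i).
Proof. by move=> iB g h; apply: msumB => q a b; rewrite iB monalgUB. Qed.

Lemma malg_mapU (A B : zmodType) (i : A -> B) a q :
  zmod_morphism i -> malg_map i << a *g q >> = << i a *g q >>.
Proof.
by move=> iB; apply: msumU => p; rewrite (zmod_morphism0 iB) monalgU0.
Qed.

Lemma mcoeff_malg_map (A B : zmodType) (i : A -> B) g q :
  zmod_morphism i -> (malg_map i g)@_q = i g@_q.
Proof.
move=> iB; move: g; apply: malg_ext => [g h|g h|p a].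
- by rewrite malg_mapB // mcoeffB.
- by rewrite mcoeffB iB.
by rewrite malg_mapU // !mcoeffU; case: eqP; rewrite ?mulr1n ?mulr0n ?(zmod_morphism0 iB).
Qed.

Lemma malg_map_inj (A B : zmodType) (i : A -> B) :
  zmod_morphism i -> injective i -> injective (malg_map i).
Proof.
by move=> iB iI g h /malgP e; apply/malgP => q; apply: iI; rewrite -!mcoeff_malg_map.
Qed.

Lemma coordinate_inj (A B T T' : zmodType) (i : A -> B) (f : T -> T')
    (c : T -> {malg A[X]}) (c' : T' -> {malg B[X]}) :
  zmod_morphism i -> injective i -> injective c ->
  (forall t, c' (f t) = malg_map i (c t)) -> injective f.
Proof.
move=> iB iI cI e t t' ett; apply/cI/(malg_map_inj iB iI).
by rewrite -!e ett.
Qed.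
End Coordinates.

(** Coordinates along a possibly infinite generating family: only finitely many
    of them are nonzero at each element. *)
Definition has_dual_basis (S : pzRingType) (M : lmodType S) : Prop :=
  exists (X : choiceType) (e : X -> M) (s : M -> {malg S[X]}),
  [/\ zmod_morphism s,
      forall a m, s (a *: m) = malg_map ( *%R a) (s m) &
      forall m, msum (fun q a => a *: e q) (s m) = m].

Section FreeModule.
Variables (S : pzRingType) (X : choiceType).

Definition free_module : Type := {malg S[X]}.
HB.instance Definition _ := GRing.Zmodule.copy free_module {malg S[X]}.

Definition free_scale (a : S) (g : free_module) : free_module := malg_map ( *%R a) g.

Lemma mulr_zmod (a : S) : zmod_morphism ( *%R a).
Proof. by move=> b c; rewrite mulrBr. Qed.

Lemma mcoeff_free_scale a g q : (free_scale a g)@_q = a * g@_q.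
Proof. exact/mcoeff_malg_map/mulr_zmod. Qed.

Lemma free_scaleA a b g : free_scale a (free_scale b g) = free_scale (a * b) g.
Proof. by apply/malgP => q; rewrite !mcoeff_free_scale mulrA. Qed.
Lemma free_scale1 : left_id 1 free_scale.
Proof. by move=> g; apply/malgP => q; rewrite mcoeff_free_scale mul1r. Qed.
Lemma free_scaleDr : right_distributive free_scale +%R.
Proof.
move=> a g h; apply/malgP => q.
by rewrite mcoeffD !mcoeff_free_scale -mulrDr -mcoeffD.
Qed.
Lemma free_scaleDl g : {morph free_scale^~ g : a b / a + b}.
Proof.
by move=> a b; apply/malgP => q; rewrite mcoeffD !mcoeff_free_scale mulrDl.
Qed.
HB.instance Definition _ := GRing.Zmodule_isLmodule.Build S free_module
  free_scaleA free_scale1 free_scaleDr free_scaleDl.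

Lemma free_module_lift (M : lmodType S) (e : X -> M) :
  linear (fun g : free_module => msum (fun q a => a *: e q) g).
Proof.
have B : zmod_morphism (fun g : {malg S[X]} => msum (fun q a => a *: e q) g).
  by move=> g h; apply: msumB => q a b; rewrite scalerBl.
have Z a (g : {malg S[X]}) : msum (fun q a => a *: e q) (malg_map ( *%R a) g) =
    a *: msum (fun q a => a *: e q) g.
  move: g; apply: malg_ext => [g g'|g g'|q b].
  - by rewrite malg_mapB ?B //; apply: mulr_zmod.
  - by rewrite B scalerBr.
  rewrite malg_mapU; last exact: mulr_zmod.
  by rewrite !msumU => [|p|p]; rewrite ?scale0r // scalerA.
by move=> a g h; rewrite (zmod_morphismD B); congr (_ + _); apply: Z.
Qed.
End FreeModule.

Lemma projective_dual_basis (S : pzRingType) (P : lmodType S) :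
  projective_module P -> has_dual_basis P.
Proof.
move=> pP; pose p := to_linear (free_module_lift (fun x : P => x)).
have pS : surjective p.
  move=> x; exists << 1 *g x >>; rewrite to_linearE /=.
  by rewrite [LHS]msumU ?scale1r // => y; rewrite scale0r.
have [s sK] := pP _ _ p (idfun : {linear P -> P}) pS.
exists P, id, s; split=> [|a m|m]; first exact: (linear_zmod s).
  exact: (linearZ_LR s).
exact: sK.
Qed.

Section DualBasisFlat.
Variable S : pzRingType.

(** Coordinates with respect to the dual basis embed the tensor product N (x) M
    into finitely supported families in N, naturally in N; the generators
    recover the tensor from the family. On families, injectivity of N -> N' is
    inherited coefficientwise. *)
Lemma dual_basis_flat (M : lmodType S) : has_dual_basis M -> flat_module M.
Proof.
move=> [X [e [s [sB sZ sK]]]].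
pose F (N : lmodType S^c) (x : N) := fun q (a : S) => << (a : S^c) *: x *g q >> : {malg N[X]}.
have FB N x q : zmod_morphism (@F N x q).
  by move=> a b; rewrite /F scalerBl monalgUB.
have FU N x q a : msum (@F N x) << a *g q >> = F N x q a.
  by apply: msumU => p; apply: zmod_morphism0.
pose b N x m := msum (@F N x) (s m).
have bBr N x : zmod_morphism (@b N x) by move=> m m'; rewrite /b sB; apply: msumB.
have bBl N m : zmod_morphism ((@b N)^~ m).
  move=> x x'; rewrite /b; move: (s m); apply: malg_ext => [g g'|g g'|q a].
  - exact: msumB.
  - by apply: zmod_morphism_sub => ? ?; apply: msumB.
  by rewrite !FU /F -monalgUB -scalerBr.
have bZ N (r : S) x m : @b N ((r : S^c) *: x) m = b N x (r *: m).
  rewrite /b sZ; move: (s m); apply: malg_ext => [g g'|g g'|q a].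
  - exact: msumB.
  - by rewrite malg_mapB ?msumB //; apply: mulr_zmod.
  rewrite malg_mapU; last exact: mulr_zmod.
  by rewrite !FU /F scalerA.
pose c N := tensor_lift (@bBr N) (bBl N) (bZ N).
have cB N : zmod_morphism (c N) by apply: tensor_liftB.
have cE N t u : c N (pure_tensor t u) = b N t u by apply: tensor_liftE.
have cI N : injective (c N).
  pose r (g : {malg N[X]}) := msum (fun q x => @pure_tensor S N M x (e q)) g.
  have rB : zmod_morphism r by move=> g h; apply: msumB => q; apply: pure_tensorBl.
  apply: (can_inj (g := r)); apply: tensor_ext => // [|x m].
    exact: zmod_comp.
  rewrite /= cE -[in RHS](sK m) /b; move: (s m).
  apply: malg_ext => [g g'|g g'|q a].
  - by rewrite msumB // rB.
  - by rewrite msumB ?pure_tensorBr // => q y z; rewrite scalerBl.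
  rewrite FU [in RHS]msumU => [|p]; last by rewrite scale0r.
  rewrite /F [LHS]msumU ?pure_tensorZ // => p.
  exact: (zmod_morphism0 (pure_tensorBl _)).
move=> N N' i iI; have iB := linear_zmod i.
apply: (coordinate_inj iB iI (cI N) (c' := c N')).
apply: tensor_ext => [||x m].
- by apply: (zmod_comp (f := tensor_map _ _)) => //; apply: tensor_mapB.
- by apply: (zmod_comp (f := c N)) => //; apply: malg_mapB.
rewrite tensor_map_pure !cE /b; move: (s m).
apply: malg_ext => [g g'|g g'|q a].
- exact: msumB.
- by rewrite msumB // malg_mapB.
by rewrite !FU /F malg_mapU // linearZ.
Qed.

(** A module over the converse of the converse ring is not literally a module
    over the ring, so the argument is repeated with the factors exchanged. *)
Lemma dual_basis_flatl (M : lmodType S^c) : has_dual_basis M ->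
  forall (N N' : lmodType S) (i : {linear N -> N'}), injective i ->
  injective (tensor_map (idfun : {linear M -> M}) i).
Proof.
move=> [X [e [s [sB sZ sK]]]].
pose F (N : lmodType S) (x : N) := fun q (a : S^c) => << (a : S) *: x *g q >> : {malg N[X]}.
have FB N x q : zmod_morphism (@F N x q).
  by move=> a b; rewrite /F -monalgUB -scalerBl.
have FU N x q a : msum (@F N x) << a *g q >> = F N x q a.
  by apply: msumU => p; apply: zmod_morphism0.
pose b N m x := msum (@F N x) (s m).
have bBl N x : zmod_morphism ((@b N)^~ x) by move=> m m'; rewrite /b sB; apply: msumB.
have bBr N m : zmod_morphism (@b N m).
  move=> x x'; rewrite /b; move: (s m); apply: malg_ext => [g g'|g g'|q a].
  - exact: msumB.
  - by apply: zmod_morphism_sub => ? ?; apply: msumB.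
  by rewrite !FU /F -monalgUB -scalerBr.
have bZ N (r : S) m x : @b N ((r : S^c) *: m) x = b N m (r *: x).
  rewrite /b sZ; move: (s m); apply: malg_ext => [g g'|g g'|q a].
  - by rewrite malg_mapB ?msumB //; apply: mulr_zmod.
  - exact: msumB.
  rewrite malg_mapU; last exact: mulr_zmod.
  by rewrite !FU /F scalerA.
pose c N := tensor_lift (bBr N) (@bBl N) (bZ N).
have cB N : zmod_morphism (c N) by apply: tensor_liftB.
have cE N t u : c N (pure_tensor t u) = b N t u by apply: tensor_liftE.
have cI N : injective (c N).
  pose r (g : {malg N[X]}) := msum (fun q x => @pure_tensor S M N (e q) x) g.
  have rB : zmod_morphism r by move=> g h; apply: msumB => q; apply: pure_tensorBr.
  apply: (can_inj (g := r)); apply: tensor_ext => // [|m x].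
    exact: zmod_comp.
  rewrite /= cE -[in RHS](sK m) /b; move: (s m).
  apply: malg_ext => [g g'|g g'|q a].
  - by rewrite msumB // rB.
  - by rewrite msumB ?pure_tensorBl // => q y z; rewrite scalerBl.
  rewrite FU [in RHS]msumU => [|p]; last by rewrite scale0r.
  rewrite /F [LHS]msumU ?pure_tensorZ // => p.
  exact: (zmod_morphism0 (pure_tensorBr _)).
move=> N N' i iI; have iB := linear_zmod i.
apply: (coordinate_inj iB iI (cI N) (c' := c N')).
apply: tensor_ext => [||m x].
- by apply: (zmod_comp (f := tensor_map _ _)) => //; apply: tensor_mapB.
- by apply: (zmod_comp (f := c N)) => //; apply: malg_mapB.
rewrite tensor_map_pure !cE /b; move: (s m).
apply: malg_ext => [g g'|g g'|q a].
- exact: msumB.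
- by rewrite msumB // malg_mapB.
by rewrite !FU /F malg_mapU // linearZ.
Qed.
End DualBasisFlat.

Lemma projective_flat (S : pzRingType) (P : lmodType S) :
  projective_module P -> flat_module P.
Proof. by move/projective_dual_basis/dual_basis_flat. Qed.

(** * Modules over a group ring *)

Section GroupRingModules.
Variables (k : comPzRingType) (G : groupType).
Local Notation R := (group_ring k G).
Implicit Types (M : lmodType R) (N : lmodType R^c).

Lemma gr_ofM (a b : k) (x y : G) : gr_of a x * gr_of b y = gr_of (a * b) (x * y)%g :> R.
Proof. exact: gr_mulU. Qed.

Lemma gr_of_central (a : k) (u : R) : gr_of a 1%g * u = u * gr_of a 1%g.
Proof.
move: u; apply: malg_ext => [u v|u v|x b].
- by rewrite mulrBr.
- by rewrite mulrBl.
by rewrite -[<< _ *g _ >>]/(gr_of b x) !gr_ofM mulrC mul1g mulg1.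
Qed.

(** Scalars are moved across a tensor product over k from a module over the
    converse ring to a module, so left modules are restricted to the converse of
    k and right modules to k itself. *)
Definition left_restrict M : Type := M.
Section LeftRestrict.
Variable M : lmodType R.
HB.instance Definition _ := GRing.Zmodule.copy (left_restrict M) M.
Definition left_restrict_scale (a : k^c) (m : left_restrict M) : left_restrict M :=
  gr_of (a : k) 1%g *: (m : M).
Lemma left_restrict_scaleA a b m :
  left_restrict_scale a (left_restrict_scale b m) = left_restrict_scale (a * b) m.
Proof. by rewrite /left_restrict_scale scalerA gr_ofM mulg1 mulrC. Qed.
Lemma left_restrict_scale1 : left_id 1 left_restrict_scale.
Proof. by move=> m; apply: scale1r. Qed.
Lemma left_restrict_scaleDr : right_distributive left_restrict_scale +%R.
Proof. by move=> a m m'; apply: scalerDr. Qed.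
Lemma left_restrict_scaleDl m : {morph left_restrict_scale^~ m : a b / a + b}.
Proof.
move=> a b; rewrite /left_restrict_scale.
by rewrite (zmod_morphismD (@gr_ofB k G 1%g)) scalerDl.
Qed.
HB.instance Definition _ := GRing.Zmodule_isLmodule.Build k^c (left_restrict M)
  left_restrict_scaleA left_restrict_scale1 left_restrict_scaleDr left_restrict_scaleDl.
End LeftRestrict.

Definition right_restrict N : Type := N.
Section RightRestrict.
Variable N : lmodType R^c.
HB.instance Definition _ := GRing.Zmodule.copy (right_restrict N) N.
Definition right_restrict_scale (a : k) (x : right_restrict N) : right_restrict N :=
  (gr_of a 1%g : R^c) *: (x : N).
Lemma right_restrict_scaleA a b x :
  right_restrict_scale a (right_restrict_scale b x) = right_restrict_scale (a * b) x.
Proof.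
rewrite /right_restrict_scale scalerA; congr (_ *: _).
by rewrite [LHS]gr_ofM mulg1 mulrC.
Qed.
Lemma right_restrict_scale1 : left_id 1 right_restrict_scale.
Proof. by move=> x; apply: scale1r. Qed.
Lemma right_restrict_scaleDr : right_distributive right_restrict_scale +%R.
Proof. by move=> a x y; apply: scalerDr. Qed.
Lemma right_restrict_scaleDl x : {morph right_restrict_scale^~ x : a b / a + b}.
Proof.
move=> a b; rewrite /right_restrict_scale.
by rewrite (zmod_morphismD (@gr_ofB k G 1%g)) scalerDl.
Qed.
HB.instance Definition _ := GRing.Zmodule_isLmodule.Build k (right_restrict N)
  right_restrict_scaleA right_restrict_scale1 right_restrict_scaleDr right_restrict_scaleDl.
End RightRestrict.

Lemma left_restrict_linear M M' (f : {linear M -> M'}) :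
  linear (f : left_restrict M -> left_restrict M').
Proof. by move=> a x y; apply: linearP. Qed.

Definition left_restrict_map M M' (f : {linear M -> M'}) :
    {linear left_restrict M -> left_restrict M'} :=
  to_linear (left_restrict_linear f).

Lemma left_scale_linear M (u : R) :
  linear (fun m : left_restrict M => (u *: (m : M) : left_restrict M)).
Proof.
move=> a x y; rewrite [LHS]scalerDr; congr (_ + _).
by rewrite [LHS]scalerA -gr_of_central -scalerA.
Qed.

Lemma right_scale_linear N (u : R) :
  linear (fun x : right_restrict N => ((u : R^c) *: (x : N) : right_restrict N)).
Proof.
move=> a x y; rewrite [LHS]scalerDr; congr (_ + _).
rewrite [LHS]scalerA [RHS]scalerA.
exact: (congr1 (fun v : R^c => v *: (x : N)) (gr_of_central a u)).
Qed.

(** The products of scalars and group elements span the group ring, so an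
    action of these products that is additive in the scalar extends to it. *)
Section RightModule.
Variables (V : zmodType) (act : k -> G -> V -> V).
Hypothesis actBl : forall g v, zmod_morphism (fun a => act a g v).
Hypothesis actBr : forall a g, zmod_morphism (act a g).
Hypothesis act1 : forall v, act 1 1%g v = v.
Hypothesis actM : forall a b g h v, act b h (act a g v) = act (a * b) (g * h)%g v.

Definition right_module
  (_ : forall g v, zmod_morphism (fun a => act a g v))
  (_ : forall a g, zmod_morphism (act a g))
  (_ : forall v, act 1 1%g v = v)
  (_ : forall a b g h v, act b h (act a g v) = act (a * b) (g * h)%g v) : Type := V.
Local Notation Q := (right_module actBl actBr act1 actM).
HB.instance Definition _ := GRing.Zmodule.copy Q V.

Definition right_module_scale (u : R^c) (v : Q) : Q :=
  msum (fun g a => act a g v) (u : {malg k[G]}).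

Lemma right_module_scaleU a g v : right_module_scale (gr_of a g) v = act a g v.
Proof. by apply: msumU => h; apply: (zmod_morphism0 (actBl h v)). Qed.

Lemma right_module_scaleBl v : zmod_morphism (right_module_scale^~ v).
Proof. by move=> u u'; apply: msumB => g; apply: actBl. Qed.

Lemma right_module_scaleBr u : zmod_morphism (right_module_scale u).
Proof.
move=> v w; move: u; apply: malg_ext => [u u'|u u'|g a].
- exact: right_module_scaleBl.
- by apply: zmod_morphism_sub ; apply: right_module_scaleBl.
by rewrite -!/(gr_of a g) !right_module_scaleU actBr.
Qed.

Lemma right_module_scaleA u w v :
  right_module_scale u (right_module_scale w v) = right_module_scale (u * w) v.
Proof.
move: u; apply: malg_ext => [u u'|u u'|h b].
- exact: right_module_scaleBl.
- by rewrite mulrBl right_module_scaleBl.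
move: w; apply: malg_ext => [w w'|w w'|g a].
- by rewrite right_module_scaleBl right_module_scaleBr.
- by rewrite mulrBr right_module_scaleBl.
rewrite -!/(gr_of _ _) !right_module_scaleU actM.
by rewrite -right_module_scaleU -gr_ofM.
Qed.

Lemma right_module_scale1 : left_id 1 right_module_scale.
Proof. by move=> v; rewrite [LHS]right_module_scaleU act1. Qed.

Lemma right_module_scaleDr : right_distributive right_module_scale +%R.
Proof. by move=> u v w; apply: zmod_morphismD (right_module_scaleBr u) _ _. Qed.

Lemma right_module_scaleDl v : {morph right_module_scale^~ v : u w / u + w}.
Proof. exact/zmod_morphismD/right_module_scaleBl. Qed.

HB.instance Definition _ := GRing.Zmodule_isLmodule.Build R^c Q
  right_module_scaleA right_module_scale1 right_module_scaleDr right_module_scaleDl.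
End RightModule.

(** Equivariance need only be tested on the additive generators of the ring. *)
Lemma gr_linear N N' (f : N -> N') : zmod_morphism f ->
  (forall a g x, f ((gr_of a g : R^c) *: x) = (gr_of a g : R^c) *: f x) ->
  linear f.
Proof.
move=> fB fU u x y; rewrite (zmod_morphismD fB); congr (_ + _).
move: u; apply: malg_ext => [u v|u v|g a].
- by rewrite scalerBl fB.
- by rewrite scalerBl.
exact: fU.
Qed.

End GroupRingModules.

(** * Diagonal tensor products *)

Section Diagonal.
Variables (k : comPzRingType) (G : groupType).
Local Notation R := (group_ring k G).
Implicit Types (M A B : lmodType R) (I : lmodType R^c) (N : lmodType k).

Section Action.
Variables (M : lmodType R) (I : lmodType R^c).

(** On the tensor product over k of a left and a right module, g acts on the
    right by sending m (x) x to g^-1 m (x) x g. *)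
Definition diagonal_act (a : k) (g : G) :
    tensor (left_restrict M) (right_restrict I) ->
    tensor (left_restrict M) (right_restrict I) :=
  tensor_map (to_linear (@left_scale_linear k G M (gr_of 1 g^-1%g)))
             (to_linear (@right_scale_linear k G I (gr_of a g))).

Lemma diagonal_act_pure a g (m : M) (x : I) :
  diagonal_act a g (pure_tensor (m : left_restrict M) (x : right_restrict I)) =
  pure_tensor (gr_of 1 g^-1%g *: m : left_restrict M)
    ((gr_of a g : R^c) *: x : right_restrict I).
Proof. exact: tensor_map_pure. Qed.

Lemma diagonal_actBl g v : zmod_morphism (fun a => diagonal_act a g v).
Proof.
move=> a b; move: v; apply: tensor_ext => [||m x].
- exact: tensor_mapB.
- by apply: zmod_morphism_sub; apply: tensor_mapB.
rewrite !diagonal_act_pure -pure_tensorBr; congr pure_tensor.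
by rewrite gr_ofB; apply: (@scalerBl R^c I).
Qed.

Lemma diagonal_actBr a g : zmod_morphism (diagonal_act a g).
Proof. exact: tensor_mapB. Qed.

Lemma diagonal_act1 v : diagonal_act 1 1%g v = v.
Proof.
by apply: tensor_map_id => m; rewrite /= ?invg1 [LHS]scale1r.
Qed.

Lemma diagonal_actM a b g h v :
  diagonal_act b h (diagonal_act a g v) = diagonal_act (a * b) (g * h)%g v.
Proof.
apply: tensor_map_comp => m; rewrite /= [LHS]scalerA; last first.
  by rewrite -gr_ofM.
by rewrite gr_ofM mulr1 invgM.
Qed.

Definition diagonal_tensor : lmodType R^c :=
  right_module diagonal_actBl diagonal_actBr diagonal_act1 diagonal_actM.

Definition diag_pure (m : M) (x : I) : diagonal_tensor :=
  pure_tensor (m : left_restrict M) (x : right_restrict I).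

Lemma diag_pureBl x : zmod_morphism (diag_pure^~ x).
Proof. exact: (@pure_tensorBl k (left_restrict M) (right_restrict I) x). Qed.

Lemma diag_pureBr m : zmod_morphism (diag_pure m).
Proof. exact: (@pure_tensorBr k (left_restrict M) (right_restrict I) m). Qed.

Lemma diag_pureZ (a : k) m x :
  diag_pure (gr_of a 1%g *: m) x = diag_pure m ((gr_of a 1%g : R^c) *: x).
Proof. exact: (@pure_tensorZ k (left_restrict M) (right_restrict I) a m x). Qed.

Lemma diag_pure_gr (a : k) g m x :
  (gr_of a g : R^c) *: diag_pure m x =
  diag_pure (gr_of 1 g^-1%g *: m) ((gr_of a g : R^c) *: x).
Proof. by rewrite [LHS]right_module_scaleU diagonal_act_pure. Qed.

Lemma diag_ext (W : zmodType) (f g : diagonal_tensor -> W) :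
  zmod_morphism f -> zmod_morphism g ->
  (forall m x, f (diag_pure m x) = g (diag_pure m x)) -> f =1 g.
Proof. by move=> fB gB e; apply: tensor_ext. Qed.

Lemma diag_lift (W : zmodType) (b : M -> I -> W) :
  (forall m, zmod_morphism (b m)) -> (forall x, zmod_morphism (b^~ x)) ->
  (forall (a : k) m x, b (gr_of a 1%g *: m) x = b m ((gr_of a 1%g : R^c) *: x)) ->
  exists f : diagonal_tensor -> W,
    zmod_morphism f /\ forall m x, f (diag_pure m x) = b m x.
Proof.
exact: (@tensor_lift_exists k (left_restrict M) (right_restrict I) W b).
Qed.
End Action.

Lemma diag_map_linear M M' I (f : {linear M -> M'}) :
  linear (tensor_map (left_restrict_map f) idfun : diagonal_tensor M I -> diagonal_tensor M' I).
Proof.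
have B : zmod_morphism (tensor_map (left_restrict_map f) idfun : diagonal_tensor M I -> diagonal_tensor M' I).
  exact: tensor_mapB.
apply: gr_linear => // a g; apply: diag_ext => [||m x].
- by move=> s t; rewrite scalerBr B.
- by move=> s t; rewrite -scalerBr B.
rewrite diag_pure_gr.
rewrite ![tensor_map _ _ _]tensor_map_pure.
rewrite [RHS]diag_pure_gr; congr (diag_pure _ _).
exact: linearZ.
Qed.

Definition diag_map M M' I (f : {linear M -> M'}) :
    {linear diagonal_tensor M I -> diagonal_tensor M' I} :=
  to_linear (@diag_map_linear M M' I f).

Lemma diag_map_pure M M' I (f : {linear M -> M'}) m (x : I) :
  diag_map I f (diag_pure m x) = diag_pure (f m) x.
Proof. exact: tensor_map_pure. Qed.

(** Both sides are the coinvariants of the diagonal action on the tensor product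
    of A, M and I over k, so A and M play symmetric roles. *)
Section Swap.
Variables (A M : lmodType R) (I : lmodType R^c).

Lemma diag_swap_exists : exists sw : tensor (diagonal_tensor A I) M ->
                                     tensor (diagonal_tensor M I) A,
  zmod_morphism sw /\ forall a x m,
    sw (pure_tensor (diag_pure a x) m) = pure_tensor (diag_pure m x) a.
Proof.
have inner (m : M) : exists f : diagonal_tensor A I -> tensor (diagonal_tensor M I) A,
    zmod_morphism f /\ forall a x, f (diag_pure a x) = pure_tensor (diag_pure m x) a.
  apply: diag_lift => [a|x|r a x].
  - by move=> x y; rewrite diag_pureBr pure_tensorBl.
  - exact: pure_tensorBr.
  - rewrite -(@pure_tensorZ R (diagonal_tensor M I) A) diag_pure_gr invg1.
    by rewrite -[gr_of 1 1%g]/(1 : R) scale1r.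
have [b bP] := choice inner.
have bB m : zmod_morphism (b m) by case: (bP m).
have bE m a x : b m (diag_pure a x) = pure_tensor (diag_pure m x) a.
  by case: (bP m).
have bBl t : zmod_morphism (b^~ t).
  move=> m m'; move: t; apply: diag_ext => // [|a x].
    exact: zmod_morphism_sub.
  by rewrite !bE diag_pureBl pure_tensorBl.
have bZ (u : R) t m : b m ((u : R^c) *: t) = b (u *: m) t.
  move: u; apply: malg_ext => [u u'|u u'|g r].
  - by rewrite scalerBl bB.
  - by rewrite scalerBl bBl.
  move: t; apply: diag_ext => [t t'|//|a x].
    by rewrite scalerBr bB.
  rewrite diag_pure_gr !bE -(@pure_tensorZ R (diagonal_tensor M I) A).
  rewrite diag_pure_gr invgK -[<< r *g g >>]/(gr_of r g).
  have -> : gr_of r g *: m = gr_of r 1%g *: (gr_of 1 g *: m).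
    by rewrite scalerA gr_ofM mulr1 mul1g.
  rewrite (diag_pureZ r (gr_of 1 g *: m)).
  apply: (congr1 (fun y : I => pure_tensor (diag_pure (gr_of 1 g *: m) y) a)).
  rewrite [LHS]scalerA; apply: (congr1 (fun u : R^c => u *: x)).
  by rewrite [LHS]gr_ofM mulr1 mulgV.
have [f [fB fE]] := tensor_lift_exists (b := fun t m => b m t) bBl bB bZ.
by exists f; split=> // a x m; rewrite fE bE.
Qed.
End Swap.

Definition diag_swap A M I := projT1 (cid (diag_swap_exists A M I)).

Lemma diag_swapB A M I : zmod_morphism (@diag_swap A M I).
Proof. by rewrite /diag_swap; case: cid => f []. Qed.

Lemma diag_swap_pure A M I a x m :
  @diag_swap A M I (pure_tensor (diag_pure a x) m) = pure_tensor (diag_pure m x) a.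
Proof. by rewrite /diag_swap; case: cid => f []. Qed.

Lemma tensor_diag_ext A M I (W : zmodType)
    (f g : tensor (diagonal_tensor A I) M -> W) :
  zmod_morphism f -> zmod_morphism g ->
  (forall a x m, f (pure_tensor (diag_pure a x) m) = g (pure_tensor (diag_pure a x) m)) ->
  f =1 g.
Proof.
move=> fB gB e; apply: tensor_ext => // t m; move: t; apply: diag_ext => //.
  by move=> s t; rewrite pure_tensorBl fB.
by move=> s t; rewrite pure_tensorBl gB.
Qed.

Lemma diag_swapK A M I : cancel (@diag_swap A M I) (@diag_swap M A I).
Proof.
apply: tensor_diag_ext => // [|a x m].
  by move=> s t; rewrite !diag_swapB.
by rewrite !diag_swap_pure.
Qed.

Lemma diag_swap_natural A A' M M' I (f : {linear A -> A'}) (g : {linear M -> M'}) t :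
  diag_swap (tensor_map (diag_map I f) g t) =
  tensor_map (diag_map I g) f (diag_swap t).
Proof.
move: t; apply: tensor_diag_ext => [s t|s t|a x m].
- by rewrite tensor_mapB diag_swapB.
- by rewrite diag_swapB tensor_mapB.
by rewrite tensor_map_pure diag_map_pure !diag_swap_pure tensor_map_pure diag_map_pure.
Qed.

(** The module against which injectivity is tested moves into the second factor,
    where its flatness over the group ring can be used. *)
Lemma diag_swap_inj A A' M M' I (f : {linear A -> A'}) (g : {linear M -> M'}) :
  injective (tensor_map (diag_map I g) f) -> injective (tensor_map (diag_map I f) g).
Proof.
move=> fgI s t e; apply/(can_inj (@diag_swapK A M I))/fgI.
by rewrite -!diag_swap_natural e.
Qed.
End Diagonal.

(** * Restriction of injective modules *)

Section Induced.
Variables (k : comPzRingType) (G : groupType).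
Local Notation R := (group_ring k G).
Variable A : lmodType k.

(** The induced module is the tensor product over k of A and the group ring,
    written as finitely supported families of elements of A indexed by G. *)
Definition induced_act (a : k) (g : G) (v : {malg A[G]}) : {malg A[G]} :=
  msum (fun h x => << a *: x *g (h * g)%g >>) v.

Lemma induced_actBr a g : zmod_morphism (induced_act a g).
Proof. by move=> v w; apply: msumB => h x y; rewrite scalerBr monalgUB. Qed.

Lemma induced_actU a g h x : induced_act a g << x *g h >> = << a *: x *g (h * g)%g >>.
Proof. by apply: msumU => h'; rewrite scaler0 monalgU0. Qed.

Lemma induced_actBl g v : zmod_morphism (fun a => induced_act a g v).
Proof.
move=> a b; move: v; apply: malg_ext => [v w|v w|h x].
- exact: induced_actBr.
- by apply: zmod_morphism_sub; apply: induced_actBr.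
by rewrite !induced_actU scalerBl monalgUB.
Qed.

Lemma induced_act1 v : induced_act 1 1%g v = v.
Proof.
move: v; apply: malg_ext => [v w|//|h x]; first exact: induced_actBr.
by rewrite induced_actU scale1r mulg1.
Qed.

Lemma induced_actM a b g h v :
  induced_act b h (induced_act a g v) = induced_act (a * b) (g * h)%g v.
Proof.
move: v; apply: malg_ext => [v w|v w|l x]; rewrite ?induced_actBr //.
by rewrite !induced_actU scalerA mulrC mulgA.
Qed.

Definition induced : lmodType R^c :=
  right_module induced_actBl induced_actBr induced_act1 induced_actM.
End Induced.

Section RestrictInjective.
Variables (k : comPzRingType) (G : groupType).
Local Notation R := (group_ring k G).

(** Extension problems into the restriction of I become extension problems into
    I after induction, and induction preserves injectivity coefficientwise. *)
Lemma right_restrict_injective (I : lmodType R^c) :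
  injective_module I -> injective_module (right_restrict I).
Proof.
move=> injI A B i f iI.
have iB := linear_zmod i.
have iL : linear (malg_map i : induced G A -> induced G B).
  apply: gr_linear => [|a g v]; first exact: malg_mapB.
  rewrite ![_ *: _]right_module_scaleU.
  move: v; apply: malg_ext => [v w|v w|h x].
  - by rewrite induced_actBr malg_mapB.
  - by rewrite malg_mapB // induced_actBr.
  by rewrite induced_actU !malg_mapU // induced_actU linearZ.
pose F (v : induced G A) : I := msum (fun g x => (gr_of 1 g : R^c) *: (f x : I)) (v : {malg A[G]}).
have FB : zmod_morphism F.
  by move=> v w; apply: msumB => g x y; rewrite linearB scalerBr.
have FU g x : F << x *g g >> = (gr_of 1 g : R^c) *: (f x : I).
  by apply: msumU => h; rewrite linear0 scaler0.
have FL : linear F.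
  apply: gr_linear => // a g v; rewrite [_ *: v]right_module_scaleU.
  move: v; apply: malg_ext => [v w|v w|h x].
  - by rewrite induced_actBr FB.
  - by rewrite FB scalerBr.
  rewrite induced_actU !FU linearZ !scalerA.
  apply: (congr1 (fun v : R^c => v *: (f x : I))).
  by rewrite [LHS]gr_ofM [RHS]gr_ofM mul1r mulr1 mul1g.
have iiI : injective (to_linear iL) by apply: malg_map_inj.
have [g gE] := injI _ _ (to_linear iL) (to_linear FL) iiI.
have hL : linear (fun y : B => (g (<< y *g 1%g >> : {malg B[G]}) : right_restrict I)).
  move=> a y z; rewrite monalgUD [LHS]linearD; congr (_ + _).
  rewrite [RHS]/(_ *: _) /= /right_restrict_scale -linearZ; congr (g _).
  by rewrite [RHS]right_module_scaleU induced_actU mulg1.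
exists (to_linear hL) => x; rewrite to_linearE.
have := gE << x *g 1%g >>; rewrite !to_linearE malg_mapU // => ->.
by rewrite FU [LHS]scale1r.
Qed.
End RestrictInjective.

(** * Gorenstein projective modules *)

Definition short_exact (R : pzRingType) (A B C : lmodType R)
    (i : {linear A -> B}) (p : {linear B -> C}) : Prop :=
  [/\ injective i, is_exact i p & surjective p].

Section Gorenstein.
Variable R : pzRingType.
Implicit Types (M P Q Z : lmodType R).

(** This is the vanishing of the first Ext group with projective coefficients,
    in the form in which it is used. *)
Definition extends_to_projectives Z : Prop :=
  forall (X Y Q : lmodType R) (a : {linear X -> Y}) (b : {linear Y -> Z})
    (f : {linear X -> Q}),
  short_exact a b -> projective_module Q ->
  exists F : {linear Y -> Q}, forall x, F (a x) = f x.

Definition coresolved_in (C : lmodType R -> Prop) M : Prop :=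
  exists (P M' : lmodType R) (i : {linear M -> P}) (p : {linear P -> M'}),
  [/\ short_exact i p, projective_module P & C M'].

(** The differentials of a complex are indexed by their target, so a degree has
    to be presented as a successor before its cycles can be considered. *)
Lemma int_succ (n : int) : exists m : int, n = m + 1.
Proof. by exists (n - 1); rewrite subrK. Qed.

Lemma cycle_cover (C : complex R) n M (i : {linear M -> C (n + 1)}) :
  acyclic C -> injective i -> is_exact i (cdiff C n) ->
  exists p : {linear C (n + 1 + 1) -> M},
    [/\ forall x, i (p x) = cdiff C (n + 1) x, surjective p
      & is_exact (cdiff C (n + 1 + 1)) p].
Proof.
move=> aC iI iex.
have [p pE] : exists p : {linear C (n + 1 + 1) -> M}, forall x, i (p x) = cdiff C (n + 1) x.
  by apply: inj_factor => // x; apply/iex; rewrite cdiffK.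
exists p; split=> // y.
  have [x xE] : exists x, cdiff C (n + 1) x = i y.
    by apply/aC; apply: exact_comp0 iex.
  by exists x; apply: iI; rewrite pE.
split=> [py|[x <-]]; first by apply/aC; rewrite -pE py linear0.
by apply: (linear_eq0 iI); rewrite pE cdiffK.
Qed.

Lemma gorenstein_projective_coresolved M :
  gorenstein_projective M -> coresolved_in (@gorenstein_projective R) M.
Proof.
move=> [C cC [n [i [iI iex]]]].
case: (int_succ n) i iI iex => m -> i iI iex.
have [K [j [jI jex]]] := kernel_exists (cdiff C m).
have [aC pC _] := cC; have [p [pE pS _]] := cycle_cover aC jI jex.
exists (C (m + 1 + 1)), K, i, p; split=> //; last by exists C => //; exists m, j.
split=> // y; rewrite -iex -pE; split=> [->|/(linear_eq0 jI) //]; exact: linear0.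
Qed.

(** Cover M by a projective term of a complete resolution, lift the cover to Y,
    and read off the obstruction to extending f as a cocycle with values in Q.
    It is a coboundary because the resolution stays exact under Hom into Q, and
    the cochain g that bounds it glues with f to a map on Y. *)
Lemma gorenstein_projective_extends M :
  gorenstein_projective M -> extends_to_projectives M.
Proof.
move=> [C [aC pC hC] [n [i [iI iex]]]] X Y Q a b f [aI abex bS] pQ.
have [e [eE eS eex]] := cycle_cover aC iI iex.
have [l lE] := pC _ _ _ b e bS.
have [h hE] : exists h : {linear C (n + 1 + 1 + 1) -> X},
    forall x, a (h x) = l (cdiff C (n + 1 + 1) x).
  apply: (inj_factor (f := l \o cdiff C (n + 1 + 1))) => // x.
  by apply/abex; rewrite lE (exact_comp0 _ eex).
have [g gE] : exists g : {linear C (n + 1 + 1) -> Q},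
    forall x, g (cdiff C (n + 1 + 1) x) = (f \o h) x.
  apply/(hC Q pQ) => x /=.
  suff -> : h (cdiff C (n + 1 + 1 + 1) x) = 0 by rewrite linear0.
  by apply/(linear_eq0 aI); rewrite hE cdiffK linear0.
have [||F FE] := surj_factor (p := sum_map a l) (f := sum_map f g).
- move=> y; have [c cE] := eS (b y).
  have [x xE] : exists x, a x = y - l c by apply/abex; rewrite linearB lE cE subrr.
  by exists (x, c); rewrite /= /sum_map /= xE subrK.
- move=> [x c]; rewrite /= /sum_map /= => xc0.
  have [c' c'E] : exists c', cdiff C (n + 1 + 1) c' = c.
    by apply/eex; rewrite -lE -[l c](addKr (a x)) xc0 addr0 linearN (exact_comp0 _ abex) oppr0.
  have -> : x = - h c'.
    apply: aI; rewrite linearN hE c'E; apply/eqP; rewrite -addr_eq0; exact/eqP.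
  by rewrite -c'E gE linearN addNr.
exists F => x; rewrite -[RHS]addr0 -(linear0 g) -[RHS]/(sum_map f g (x, 0)) -FE.
by rewrite /= /sum_map /= linear0 addr0.
Qed.

(** The cokernels of the hulls below are iterated extensions of Gorenstein
    projective modules. Working with the smallest class closed under extensions
    avoids proving that extensions of Gorenstein projective modules are again
    Gorenstein projective. *)
Inductive gorenstein_filtered : lmodType R -> Prop :=
| filtered_gp M : gorenstein_projective M -> gorenstein_filtered M
| filtered_ext Z1 Z Z2 (i : {linear Z1 -> Z}) (p : {linear Z -> Z2}) :
    short_exact i p -> gorenstein_filtered Z1 -> gorenstein_filtered Z2 ->
    gorenstein_filtered Z.

(** Extend in two steps, through the preimage Y1 in Y of the submodule Z1. *)
Lemma extends_to_projectives_ext Z1 Z Z2 (i : {linear Z1 -> Z}) (p : {linear Z -> Z2}) :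
  short_exact i p -> extends_to_projectives Z1 -> extends_to_projectives Z2 ->
  extends_to_projectives Z.
Proof.
move=> [iI ipex pS] e1 e2 X Y Q a b f [aI abex bS] pQ.
have [Y1 [j [jI jex]]] := kernel_exists (p \o b).
have [a1 a1E] : exists a1 : {linear X -> Y1}, forall x, j (a1 x) = a x.
  apply: inj_factor => // x; apply/jex.
  by rewrite /= (exact_comp0 _ abex) linear0.
have [b1 b1E] : exists b1 : {linear Y1 -> Z1}, forall y, i (b1 y) = (b \o j) y.
  by apply: inj_factor => // y; apply/ipex; apply: (exact_comp0 _ jex).
have [|//|F FE] := e1 _ _ Q a1 b1 f.
  split=> [x x' /(congr1 j)|y|z]; first by rewrite !a1E => /aI.
    split=> [by0|[x <-]]; last by apply: iI; rewrite b1E /= a1E (exact_comp0 _ abex) linear0.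
    have [x xE] : exists x, a x = j y by apply/abex; rewrite -[b _]b1E by0 linear0.
    by exists x; apply: jI; rewrite a1E.
  have [y yE] := bS (i z).
  have [y1 y1E] : exists y1, j y1 = y.
    by apply/jex; rewrite /= yE (exact_comp0 _ ipex).
  by exists y1; apply: iI; rewrite b1E /= y1E.
have [|//|F' F'E] := e2 _ _ Q j (p \o b) F.
  by split=> // z; have [y <-] := pS z; have [x <-] := bS y; exists x.
by exists F' => x; rewrite -a1E F'E FE.
Qed.

Lemma filtered_extends Z : gorenstein_filtered Z -> extends_to_projectives Z.
Proof.
elim=> [M|Z1 Z' Z2 i p se _ e1 _ e2]; first exact: gorenstein_projective_extends.
exact: extends_to_projectives_ext se e1 e2.
Qed.

(** The cokernel of a submodule W of P1 * P2 is an extension of P2 modulo the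
    projection of W by P1 modulo the trace of W. It computes both cokernels in
    the horseshoe construction and in the construction of hulls. *)
Lemma cokernel_pair_ext (X P1 P2 E Z1 Z2 Z1' Z2' : lmodType R)
    (h : {linear X -> (P1 * P2)%type})
    (c : {linear (P1 * P2)%type -> E})
    (i1 : {linear Z1 -> P1}) (q1 : {linear P1 -> Z1'})
    (i2 : {linear Z2 -> P2}) (q2 : {linear P2 -> Z2'}) :
  surjective c -> is_exact h c -> short_exact i1 q1 -> short_exact i2 q2 ->
  (forall p, (exists x, h x = (p, 0)) <-> (exists z, i1 z = p)) ->
  (forall q, (exists x p, h x = (p, q)) <-> (exists z, i2 z = q)) ->
  exists (a : {linear Z1' -> E}) (b : {linear E -> Z2'}), short_exact a b.
Proof.
move=> cS hcex [i1I ex1 q1S] [i2I ex2 q2S] H1 H2.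
have [//||a aE] := surj_factor (p := q1) (f := c \o pair_map idfun \0).
  by move=> p /ex1/H1[x xE] /=; rewrite -[pair_map _ _ p]/(p, 0) -xE (exact_comp0 _ hcex).
have [//||b bE] := surj_factor (p := c) (f := sum_map \0 q2).
  move=> [p q] /hcex[x xE]; rewrite /= /sum_map /= add0r.
  by apply/ex2/H2; exists x, p.
have {}aE p : a (q1 p) = c (p, 0) by rewrite aE.
have {}bE p q : b (c (p, q)) = q2 q by rewrite bE /= /sum_map /= add0r.
exists a, b; split.
- apply: linear_inj => z; have [p <-] := q1S z; rewrite aE => /hcex[x xE].
  by apply/ex1/H1; exists x.
- move=> e; split=> [|[z <-]].
    have [[p q] <-] := cS e; rewrite bE => /ex2/H2[x [p' xE]].
    exists (q1 (p - p')); rewrite aE.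
    apply/eqP; rewrite -subr_eq0 -linearB; apply/eqP/hcex; exists (- x).
    rewrite linearN xE; congr (_, _); first by rewrite /= addrAC subrr add0r.
    by rewrite /= add0r.
  by have [p' <-] := q1S z; rewrite aE bE linear0.
- by move=> z; have [q <-] := q2S z; exists (c (0, q)).
Qed.

(** The horseshoe lemma: Z1 -> P1 extends to Z' because Z2 has no first Ext group
    into projectives, and together with Z' -> Z2 -> P2 it embeds Z'. *)
Lemma filtered_coresolved Z :
  gorenstein_filtered Z -> coresolved_in gorenstein_filtered Z.
Proof.
elim=> [M|Z1 Z' Z2 i p [iI ipex pS] _ [P1 [Z1' [i1 [q1 [se1 pP1 g1]]]]] f2].
  case/gorenstein_projective_coresolved => P [M' [i [p [se pP gM]]]].
  by exists P, M', i, p; split=> //; apply: filtered_gp.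
move=> [P2 [Z2' [i2 [q2 [se2 pP2 g2]]]]].
have [phi phiE] := filtered_extends f2 i1 (And3 iI ipex pS) pP1.
have [i1I ex1 q1S] := se1; have [i2I ex2 q2S] := se2.
have [E [c [cS cex]]] := cokernel_exists (pair_map phi (i2 \o p)).
have [|q|a [b seE]] := cokernel_pair_ext cS cex se1 se2.
- move=> y; split=> [[x [<- /(linear_eq0 i2I)/ipex[z <-]]]|[z <-]].
    by exists z; rewrite phiE.
  by exists (i z); rewrite /= /pair_map /= phiE (exact_comp0 _ ipex) linear0.
- split=> [[x [y [_ <-]]]|[z <-]]; first by exists (p x).
  by have [x <-] := pS z; exists x, (phi x).
exists (P1 * P2)%type, E, (pair_map phi (i2 \o p)), c; split; last 2 first.
- exact: pair_projective.
- exact: filtered_ext seE g1 g2.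
split=> //; apply: linear_inj => x [phix0 /(linear_eq0 i2I)/ipex[z xE]].
move: phix0; rewrite -xE phiE => /(linear_eq0 i1I) ->; exact: linear0.
Qed.
End Gorenstein.

(** * Exactness of the diagonal tensor product *)

(** Exactness follows from preservation of injections by factoring g through
    the cokernel of f. *)
Lemma left_flat_exact (S : pzRingType) (M : lmodType S^c) :
  (forall (A B : lmodType S) (i : {linear A -> B}), injective i ->
     injective (tensor_map (idfun : {linear M -> M}) i)) ->
  forall (A B C : lmodType S) (f : {linear A -> B}) (g : {linear B -> C}),
  is_exact f g ->
  is_exact (tensor_map (idfun : {linear M -> M}) f)
           (tensor_map (idfun : {linear M -> M}) g).
Proof.
move=> flM A B C f g ex.
have [D [p [pS pex]]] := cokernel_exists f.
have [//||j jE] := surj_factor (p := p) (f := g).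
  by move=> x /pex[y <-]; apply: exact_comp0 ex.
have jI : injective j.
  apply: linear_inj => z; have [x <-] := pS z; rewrite jE => /ex[y <-].
  exact: (exact_comp0 _ pex).
have gE t : tensor_map idfun g t = tensor_map (idfun : {linear M -> M}) j (tensor_map idfun p t).
  by rewrite (tensor_map_comp (f'' := idfun) (g'' := g)).
move=> t; rewrite gE; split=> [/(inj_eq0 (@tensor_mapB _ _ _ _ _ _ _) (flM _ _ j jI))|].
  by move/(tensor_exactr pex pS).
move=> /(tensor_exactr pex pS) ->; apply: zmod_morphism0; exact: tensor_mapB.
Qed.

Lemma tensor_map_exchange (S : pzRingType) (N N' : lmodType S^c) (M M' : lmodType S)
    (f : {linear N -> N'}) (g : {linear M -> M'}) t :
  tensor_map f idfun (tensor_map idfun g t) = tensor_map idfun g (tensor_map f idfun t).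
Proof. by rewrite !(tensor_map_comp (f'' := f) (g'' := g)). Qed.

Section TorAcyclic.
Variables (k : comPzRingType) (G : groupType).
Local Notation R := (group_ring k G).
Variables (I : lmodType R^c) (r : resolution (@flat_module k) (right_restrict I)).
Implicit Types (M P : lmodType R).

Local Notation KT M j := (tensor (left_restrict M) (r j)).
Local Notation dif M j := (tensor_map (idfun : {linear left_restrict M -> left_restrict M}) (rdiff r j)).
Local Notation res f j := (tensor_map (left_restrict_map f) (idfun : {linear r j -> r j})).

(** The vanishing of Tor over k of M and I in degree j + 1. *)
Definition tor_vanishes M (j : nat) : Prop := is_exact (dif M j.+1) (dif M j).

Definition tor_acyclic M : Prop := forall j, tor_vanishes M j.

Lemma left_flat_tor_acyclic M :
  has_dual_basis (left_restrict M) -> tor_acyclic M.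
Proof.
by move=> dM j; apply: (left_flat_exact (dual_basis_flatl dM) (@rdiff_exact _ _ _ r j)).
Qed.

(** The group elements form a basis of the group ring over k, so the coordinates
    over the group ring split further into coordinates in k. *)
Lemma projective_restrict_dual_basis P :
  projective_module P -> has_dual_basis (left_restrict P).
Proof.
case/projective_dual_basis => X [e [s [sB sZ sK]]].
pose F q (u : R) : {malg k^c[(X * G)%type]} :=
  msum (fun g (a : k) => << (a : k^c) *g (q, g) >>) (u : {malg k[G]}).
have FB q : zmod_morphism (F q).
  by move=> u v; apply: msumB => g a b; rewrite -monalgUB.
have FU q g a : F q (gr_of a g) = << (a : k^c) *g (q, g) >>.
  by apply: msumU => h; apply: monalgU0.
pose e' (qg : (X * G)%type) : left_restrict P := (gr_of 1 qg.2 : R) *: e qg.1.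
pose s' (m : left_restrict P) : {malg k^c[(X * G)%type]} := msum F (s m).
exists (X * G)%type, e', s'; split=> [m m'|a m|m].
- by rewrite /s' sB; apply: msumB.
- rewrite /s' [s _]sZ; move: (s m); apply: malg_ext => [g g'|g g'|q u].
  + by rewrite malg_mapB ?msumB //; apply: mulr_zmod.
  + by rewrite msumB // malg_mapB //; apply: mulr_zmod.
  rewrite malg_mapU; last exact: mulr_zmod.
  rewrite !msumU => [|p|p]; last 2 first.
  + by apply: zmod_morphism0.
  + by apply: zmod_morphism0.
  move: u; apply: malg_ext => [u v|u v|g b].
  + by rewrite mulrBr FB.
  + by rewrite FB malg_mapB //; apply: mulr_zmod.
  rewrite -[<< b *g g >>]/(gr_of b g) gr_ofM !FU malg_mapU; last exact: mulr_zmod.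
  by rewrite mul1g [a * b]mulrC.
- rewrite -[RHS](sK m) /s'; move: (s m).
  have HB : zmod_morphism (fun h : {malg k^c[(X * G)%type]} => msum (fun q a => a *: e' q) h).
    by move=> h h'; apply: msumB => q a b; rewrite scalerBl.
  apply: malg_ext => [g g'|g g'|q u].
  + by rewrite msumB // HB.
  + by apply: msumB => q u v; rewrite scalerBl.
  rewrite !msumU => [|p|p]; last 2 first.
  + by rewrite scale0r.
  + by apply: zmod_morphism0.
  move: u; apply: malg_ext => [u v|u v|g b].
  + by rewrite FB HB.
  + by rewrite scalerBl.
  rewrite -[<< b *g g >>]/(gr_of b g) FU [LHS]msumU => [|p]; last by rewrite scale0r.
  by rewrite [LHS]scalerA gr_ofM mulr1 mul1g.
Qed.

Lemma projective_tor_acyclic P : projective_module P -> tor_acyclic P.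
Proof. by move/projective_restrict_dual_basis/left_flat_tor_acyclic. Qed.

Lemma res_dif M M' (f : {linear M -> M'}) j t :
  res f j (dif M j t) = dif M' j (res f j.+1 t).
Proof. exact: tensor_map_exchange. Qed.

Section ShortExact.
Variables (M1 M2 M3 : lmodType R) (i : {linear M1 -> M2}) (p : {linear M2 -> M3}).
Hypothesis se : short_exact i p.

Let resI j : injective (res i j).
Proof. by have [iI _ _] := se; apply: (robjP r j). Qed.

Let res_exact j : is_exact (res i j) (res p j).
Proof. by have [_ ex pS] := se; apply: tensor_exactl. Qed.

Let resS j : surjective (res p j).
Proof. by have [_ _ pS] := se; apply: tensor_map_surj => // x; exists x. Qed.

Let res0 j t : res p j (res i j t) = 0.
Proof. by apply/res_exact; exists t. Qed.

Let mapB (S : pzRingType) (N N' : lmodType S^c) (M M' : lmodType S)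
    (f : {linear N -> N'}) (g : {linear M -> M'}) : zmod_morphism (tensor_map f g).
Proof. exact: tensor_mapB. Qed.

Lemma dif_dif M j t : dif M j (dif M j.+1 t) = 0.
Proof.
rewrite (tensor_map_comp (f'' := idfun) (g'' := \0)) //.
  by apply: tensor_map0; right.
by move=> x; apply: exact_comp0 (@rdiff_exact _ _ _ r j).
Qed.

Lemma tor_acyclic_extension : tor_acyclic M1 -> tor_acyclic M3 -> tor_acyclic M2.
Proof.
move=> t1 t3 j.
exact (exact_middle (@mapB _ _ _ _ _ _ _) (@mapB _ _ _ _ _ _ _) (@mapB _ _ _ _ _ _ _)
  (@mapB _ _ _ _ _ _ _) (@resI j) (zmod_morphism0 (@mapB _ _ _ _ _ _ _))
  (@res_exact j.+1) (@resS j.+2) (@res_dif _ _ i j) (@res_dif _ _ i j.+1)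
  (@res_dif _ _ p j) (@res_dif _ _ p j.+1)
  (@dif_dif M2 j) (t1 j) (t3 j)).
Qed.

(** The connecting homomorphism shifts degrees by one. *)
Lemma tor_shift j : tor_vanishes M2 j -> tor_vanishes M3 j.+1 -> tor_vanishes M1 j.
Proof.
move=> t2 t3 t; split=> [dt|[u <-]]; last exact: dif_dif.
have [u uE] : exists u, dif M2 j.+1 u = res i j.+1 t.
  by apply/t2; rewrite -res_dif dt; apply: (zmod_morphism0 (@mapB _ _ _ _ _ _ _)).
apply: (boundary_reflect (@mapB _ _ _ _ _ _ _) (@mapB _ _ _ _ _ _ _) (@res_exact j.+2)
  (@resI j.+1) (@res0 j.+1) (@res_dif _ _ i j.+1) (@res_dif _ _ p j.+1) _ (esym uE)).
move=> c /t3[v <-]; have [w <-] := resS v.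
by exists (dif M2 j.+2 w); rewrite ?dif_dif ?res_dif.
Qed.

Lemma tor_acyclic_kernel : tor_acyclic M2 -> tor_acyclic M3 -> tor_acyclic M1.
Proof. by move=> t2 t3 j; apply: tor_shift. Qed.

(** The first Tor group of M3 and I is the obstruction. An element t of the
    kernel is lifted to degree zero of the resolution of I, where it becomes a
    boundary in M2 and hence, by the vanishing of homology, in M1. *)
Lemma diag_map_inj : tor_vanishes M3 0 -> injective (diag_map I i).
Proof.
move=> t3; apply: linear_inj => t t0.
have augS M : surjective (tensor_map (idfun : {linear left_restrict M -> _}) (raug r)).
  by apply: tensor_map_surj; [move=> x; exists x|apply: raug_surj].
have augE M := tensor_exactr (N := left_restrict M) (@raug_exact _ _ _ r) (@raug_surj _ _ _ r).
have [s sE] := augS M1 t.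
have [u uE] : exists u, dif M2 0 u = res i 0 s.
  by apply/augE; rewrite -tensor_map_exchange sE.
have [l lE] : exists l, dif M1 0 l = s.
  apply: (boundary_reflect (@mapB _ _ _ _ _ _ _) (@mapB _ _ _ _ _ _ _) (@res_exact 1)
    (@resI 0) (@res0 0) (@res_dif _ _ i 0) (@res_dif _ _ p 0) _ (esym uE)).
  move=> c /t3[v <-]; have [w <-] := resS v.
  by exists (dif M2 1 w); rewrite ?dif_dif ?res_dif.
by rewrite -sE; apply/augE; exists l.
Qed.
End ShortExact.

(** Embedding M in projectives infinitely often pushes the degree of its Tor
    groups up without bound, beyond the length d of the flat resolution of I. *)
Lemma gorenstein_projective_tor_acyclic (d : nat) M :
  length_le r d -> gorenstein_projective M -> tor_acyclic M.
Proof.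
(* Degree j is at most e embeddings away from the range where r vanishes. *)
move=> rd gM j; have [e ej] : exists e, (d <= j + e)%N by exists d; apply: leq_addl.
elim: e j M gM ej => [|e IH] j M gM ej.
  have z t : t = 0 :> KT M j.+1.
    rewrite -[LHS](tensor_map_id (f := idfun) (g := idfun)) //.
    by apply: tensor_map0; right => x; apply: rd; rewrite ltnS -[j]addn0.
  move=> t; split=> [_|_]; last by rewrite (z t); apply/zmod_morphism0/tensor_mapB.
  by exists 0; rewrite (z t); apply/zmod_morphism0/tensor_mapB.
have [P [M' [i [p [se pP gM']]]]] := gorenstein_projective_coresolved gM.
apply: (tor_shift se); first exact: projective_tor_acyclic.
by apply: IH => //; rewrite addSnnS.
Qed.

Lemma filtered_tor_acyclic (d : nat) M :
  length_le r d -> gorenstein_filtered M -> tor_acyclic M.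
Proof.
move=> rd; elim=> [M' gM|Z1 Z Z2 i p se _ t1 _ t2].
  exact: gorenstein_projective_tor_acyclic rd gM.
exact: tor_acyclic_extension se t1 t2.
Qed.
End TorAcyclic.

(** * Hulls of finite projective dimension *)

Section Hull.
Variables (k : comPzRingType) (G : groupType).
Local Notation R := (group_ring k G).
Variables (I : lmodType R^c) (r : resolution (@flat_module k) (right_restrict I)).
Variable (d : nat).
Hypothesis rd : length_le r d.
Implicit Types (A B C L M P Z : lmodType R).

Local Notation triple A M := (tensor (diagonal_tensor A I) M).

Definition triple_map A A' M M' (f : {linear A -> A'}) (g : {linear M -> M'}) :
  triple A M -> triple A' M' := tensor_map (diag_map I f) g.

Lemma triple_mapB A A' M M' (f : {linear A -> A'}) (g : {linear M -> M'}) :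
  zmod_morphism (triple_map f g).
Proof. exact: tensor_mapB. Qed.

Lemma diag_map_id A (f : {linear A -> A}) : f =1 idfun -> diag_map I f =1 idfun.
Proof. by move=> f1; apply: tensor_map_id. Qed.

Lemma triple_map_idl A M M' (g : {linear M -> M'}) :
  triple_map (idfun : {linear A -> A}) g =1 tensor_map (idfun : {linear diagonal_tensor A I -> _}) g.
Proof.
apply: tensor_ext => [||t m]; try exact: tensor_mapB.
by rewrite /triple_map !tensor_map_pure diag_map_id.
Qed.

Lemma triple_map_exchange A A' M M' (f : {linear A -> A'}) (g : {linear M -> M'}) t :
  triple_map f (idfun : {linear M' -> M'}) (triple_map (idfun : {linear A -> A}) g t) =
  triple_map (idfun : {linear A' -> A'}) g (triple_map f (idfun : {linear M -> M}) t).
Proof. by rewrite !triple_map_idl; apply: tensor_map_exchange. Qed.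

Lemma diag_map_exact A B C (f : {linear A -> B}) (g : {linear B -> C}) :
  is_exact f g -> surjective g -> is_exact (diag_map I f) (diag_map I g).
Proof.
move=> ex gS.
exact: (@tensor_exactl k (left_restrict A) (left_restrict B) (left_restrict C)
  (right_restrict I) (left_restrict_map f) (left_restrict_map g) ex gS).
Qed.

Lemma diag_map_surj A B (f : {linear A -> B}) :
  surjective f -> surjective (diag_map I f).
Proof.
move=> fS; apply: (@tensor_map_surj k (left_restrict A) (left_restrict B)
  (right_restrict I) (right_restrict I) (left_restrict_map f) idfun fS).
by move=> x; exists x.
Qed.

(** Tensoring over the group ring with the diagonal tensor product of A and I
    preserves the inclusion of a syzygy. For A the trivial module this is the
    purity of I itself, which is the aim. *)
Definition syzygy_pure A : Prop :=
  forall L P Z (i : {linear L -> P}) (p : {linear P -> Z}),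
    short_exact i p -> projective_module P -> gorenstein_filtered Z ->
    injective (triple_map (idfun : {linear A -> A}) i).

(** With P in the second factor this is the flatness of P over the group ring,
    and the swap transfers it to the first factor. *)
Lemma triple_map_projective_inj A B C P (i : {linear A -> B}) (p : {linear B -> C}) :
  short_exact i p -> tor_acyclic r C -> projective_module P ->
  injective (triple_map (idfun : {linear P -> P}) i) /\
  injective (triple_map i (idfun : {linear P -> P})).
Proof.
move=> se tC pP.
have inj : injective (triple_map i (idfun : {linear P -> P})).
  exact: (projective_flat pP (diag_map_inj se (tC 0%N))).
split; last exact: inj.
exact: (@diag_swap_inj k G P P A B I idfun i inj).
Qed.

Lemma projective_syzygy_pure P : projective_module P -> syzygy_pure P.
Proof.
move=> pP L P0 Z i p se _ gZ.
by have [] := triple_map_projective_inj se (filtered_tor_acyclic rd gZ) pP.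
Qed.

(** Dimension shifting along the presentation of A: the purity of A at a syzygy L
    follows from the purity of B at the next syzygy Z, which embeds into P'. *)
Lemma syzygy_pure_cokernel B P A (u : {linear B -> P}) (v : {linear P -> A}) :
  short_exact u v -> projective_module P -> tor_acyclic r A ->
  syzygy_pure B -> syzygy_pure A.
Proof.
move=> seu pP tA gB L P0 Z i p se pP0 gZ.
have [uI uvex vS] := seu; have [iI ipex pS] := se.
have [P' [Z' [i' [p' [se' pP' gZ']]]]] := filtered_coresolved gZ.
have vPhiS M : surjective (triple_map v (idfun : {linear M -> M})).
  by apply: tensor_map_surj; [apply: diag_map_surj|move=> x; exists x].
have uPhi M : is_exact (triple_map u (idfun : {linear M -> M})) (triple_map v (idfun : {linear M -> M})).
  by apply: tensor_exactl; [apply: diag_map_exact|apply: diag_map_surj].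
have ipPhi M : is_exact (triple_map (idfun : {linear M -> M}) i) (triple_map (idfun : {linear M -> M}) p).
  have ex := @tensor_exactr _ (diagonal_tensor M I) _ _ _ _ _ ipex pS.
  move=> t; rewrite triple_map_idl; split=> [/ex[x <-]|[x <-]].
    by exists x; rewrite triple_map_idl.
  by rewrite triple_map_idl; apply/ex; exists x.
apply: inj_ker0; first exact: triple_mapB.
move=> t t0; have [s sE] := vPhiS _ t.
have [w wE] : exists w, triple_map u (idfun : {linear P0 -> P0}) w =
    triple_map (idfun : {linear P -> P}) i s.
  by apply/uPhi; rewrite triple_map_exchange sE.
have uI' : injective (triple_map u (idfun : {linear Z -> Z})).
  apply: inj_ker0 => [|c c0]; first exact: triple_mapB.
  apply: (inj_eq0 (@triple_mapB _ _ _ _ _ _) (gB _ _ _ i' p' se' pP' gZ')).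
  apply: (inj_eq0 (@triple_mapB _ _ _ _ _ _) (triple_map_projective_inj seu tA pP').2).
  by rewrite triple_map_exchange c0; apply/zmod_morphism0/triple_mapB.
have [l lE] : exists l, triple_map u (idfun : {linear L -> L}) l = s.
  apply: (boundary_reflect (@triple_mapB _ _ _ _ _ _) (@triple_mapB _ _ _ _ _ _) (ipPhi B)
    (projective_syzygy_pure pP se pP0 gZ)
    (fun x => (ipPhi P _).2 (ex_intro _ x erefl))
    (fun x => esym (triple_map_exchange u i x))
    (fun x => esym (triple_map_exchange u p x)) _ (esym wE)).
  move=> c /(inj_eq0 (@triple_mapB _ _ _ _ _ _) uI') ->.
  by exists 0; apply/zmod_morphism0/triple_mapB.
by rewrite -sE; apply/uPhi; exists l.
Qed.

Lemma gorenstein_projective_iso M M' (f : {linear M -> M'}) :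
  injective f -> surjective f -> gorenstein_projective M -> gorenstein_projective M'.
Proof.
move=> fI fS [C cC [n [i [iI iex]]]].
have [g gE] : exists g : {linear M' -> M}, forall x, f (g x) = (idfun : {linear M' -> M'}) x.
  exact: inj_factor.
exists C => //; exists n, (i \o g); split.
  by move=> x y /= /iI /(congr1 f); rewrite !gE.
move=> y; split=> [/iex[x <-]|[x <-]]; last by apply/iex; exists (g x).
by exists (f x) => /=; congr (i _); apply: fI; rewrite gE.
Qed.

Lemma resolution_kernel (X : lmodType R -> Prop) M (K : lmodType R) (s : resolution X M) n
    (j : {linear K -> s 0%N}) :
  length_le s n.+1 -> injective j -> is_exact j (raug s) ->
  exists s' : resolution X K, length_le s' n.
Proof.
move=> sn jI jex.
have [a aE] : exists a : {linear s 1%N -> K}, forall x, j (a x) = rdiff s 0 x.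
  by apply: inj_factor => // x; apply/jex; apply: exact_comp0 (@raug_exact _ _ _ s).
have aS : surjective a.
  move=> x; have [y yE] : exists y, rdiff s 0 y = j x.
    by apply/raug_exact; apply: exact_comp0 jex.
  by exists y; apply: jI; rewrite aE.
have aex : is_exact (rdiff s 1) a.
  move=> y; rewrite -(@rdiff_exact _ _ _ s) -aE.
  by split=> [->|/(linear_eq0 jI)//]; apply: linear0.
exists (Resolution (fun i => robjP s i.+1) aS aex (fun i => @rdiff_exact _ _ _ s i.+1)).
by move=> i ni x; apply: sn.
Qed.

(** Auslander and Buchweitz hulls. Let K be the first syzygy of M in its
    resolution, with hull B and quotient Z = B / K. The inclusions of s 0 and Z
    into projectives P0 and PZ combine to an embedding of B into P0 * PZ, where
    the component into P0 extends K -> s 0 -> P0 because Z has no first Ext group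
    into projectives. Then A = (P0 * PZ) / B contains M = s 0 / K, and the quotient
    A / M is an extension of PZ / Z by P0 / s 0. *)
Lemma hull_exists n M : tor_acyclic r M ->
  (exists s : resolution (@gorenstein_projective R) M, length_le s n) ->
  exists A Z (a : {linear M -> A}) (b : {linear A -> Z}),
    [/\ short_exact a b, gorenstein_filtered Z & syzygy_pure A].
Proof.
elim: n M => [|n IH] M tM [s sn].
  (* A resolution of length 0 is an isomorphism of s 0 with M. *)
  have gM : gorenstein_projective M.
    apply: (gorenstein_projective_iso (f := raug s)) (robjP s 0%N); last exact: raug_surj.
    apply: linear_inj => x /raug_exact[y <-].
    by rewrite (sn 1%N isT y) linear0.
  have [P [Z [a [b [se pP gZ]]]]] := gorenstein_projective_coresolved gM.
  exists P, Z, a, b; split; [exact: se|exact: filtered_gp|].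
  exact: (projective_syzygy_pure pP).
have [K [j [jI jex]]] := kernel_exists (raug s).
have gG0 := robjP s 0%N; have aS := @raug_surj _ _ _ s.
have tK : tor_acyclic r K.
  exact: tor_acyclic_kernel (And3 jI jex aS) (gorenstein_projective_tor_acyclic rd gG0) tM.
have [B [Z [a [b [[aI abex bS] fZ gB]]]]] := IH K tK (resolution_kernel sn jI jex).
have [P0 [G0' [i0 [q0 [se0 pP0 gG0']]]]] := gorenstein_projective_coresolved gG0.
have [PZ [Z' [iZ [qZ [seZ pPZ fZ']]]]] := filtered_coresolved fZ.
have [i0I _ _] := se0; have [iZI _ _] := seZ.
have [ph phE] := filtered_extends fZ (i0 \o j) (And3 aI abex bS) pP0.
pose h : {linear B -> (P0 * PZ)%type} := pair_map ph (iZ \o b).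
have hE x : h x = (ph x, iZ (b x)) by [].
have pP : projective_module (P0 * PZ)%type by apply: pair_projective.
have [A [v [vS vex]]] := cokernel_exists h.
have h0 x q : h x = (q, 0) -> exists2 y, x = a y & q = i0 (j y).
  rewrite hE => -[<- /(linear_eq0 iZI)/abex[y <-]].
  by exists y => //; rewrite phE.
have hI : injective h.
  apply: linear_inj => x /h0[y -> /esym/(linear_eq0 i0I)/(linear_eq0 jI) ->].
  exact: linear0.
have seA : short_exact h v by split.
have [//||al alE] := surj_factor (p := raug s) (f := v \o pair_map i0 \0).
  move=> g /jex[x <-]; apply/vex; exists (a x).
  by rewrite hE phE (exact_comp0 _ abex) linear0.
have {}alE g : al (raug s g) = v (i0 g, 0) by rewrite alE.
have alI : injective al.
  apply: linear_inj => m; have [g <-] := aS m; rewrite alE => /vex[x /h0[y _ /i0I ->]].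
  exact: exact_comp0 jex.
have [E [c [cS cex]]] := cokernel_exists al.
(* The image of h' is the preimage in P0 * PZ of the submodule M of A. *)
pose h' : {linear (s 0%N * B)%type -> (P0 * PZ)%type} := sum_map (pair_map i0 \0) h.
have h'E g x : h' (g, x) = (i0 g + ph x, iZ (b x)).
  by rewrite -[LHS]/((i0 g, 0) + h x) hE; congr (_, _); rewrite add0r.
have cvS : surjective (c \o v).
  by move=> e; have [y <-] := cS e; have [z <-] := vS y; exists z.
have cvex : is_exact h' (c \o v).
  move=> y; split=> [/cex[m]|[[g x] <-]]; last first.
    rewrite /= [h' _]/((i0 g, 0) + h x) linearD (exact_comp0 x vex) addr0 -alE.
    exact: exact_comp0 cex.
  have [g <-] := aS m; rewrite alE => e.
  have [x xE] : exists x, h x = y - (i0 g, 0) by apply/vex; rewrite linearB e subrr.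
  by exists (g, x); rewrite [LHS]/((i0 g, 0) + h x) xE [LHS]addrC subrK.
have [||a' [b' seE]] := cokernel_pair_ext cvS cvex se0 seZ.
- move=> q; split=> [[[g x]]|[g <-]]; last first.
    by exists (g, 0); rewrite h'E !linear0 addr0.
  rewrite h'E => -[<- bx0]; have [|y -> ->] := @h0 x (ph x); first by rewrite hE bx0.
  by exists (g + j y); rewrite linearD.
- move=> q; split=> [[[g x] [q' ]]|[z <-]].
    by rewrite h'E => -[_ <-]; exists (b x).
  by have [x <-] := bS z; exists (0, x), (i0 0 + ph x); rewrite h'E.
have fE : gorenstein_filtered E by apply: filtered_ext seE (filtered_gp gG0') fZ'.
have tA : tor_acyclic r A.
  exact: tor_acyclic_extension (And3 alI cex cS) tM (filtered_tor_acyclic rd fE).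
exists A, E, al, c; split; [by []|exact: fE|].
exact: (syzygy_pure_cokernel seA pP tA gB).
Qed.
End Hull.

(** * Comparison of the two dimensions *)

Section Comparison.
Variables (k : comPzRingType) (G : groupType).
Local Notation R := (group_ring k G).
Local Notation kt := (trivial_module k G : lmodType R).

(** Over k the trivial module is free on one generator. *)
Lemma trivial_restrict_dual_basis : has_dual_basis (left_restrict kt).
Proof.
exists unit, (fun=> (1 : k)), (fun m => << (m : k^c) *g tt >>).
split=> [a b|a m|m].
- exact: monalgUB.
- rewrite malg_mapU; last exact: mulr_zmod.
  congr (<< _ *g _ >>).
  by rewrite [LHS]/(augmentation _ * (m : k)) augmentationU mulrC.
- rewrite msumU => [|x]; last by rewrite scale0r.
  rewrite [LHS]/(augmentation _ * (1 : k)) augmentationU; exact: mulr1.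
Qed.

Section Unit.
Variable I : lmodType R^c.

(** The unit isomorphism I = k (x) I. *)
Definition diag_unit (x : I) : diagonal_tensor kt I :=
  @diag_pure k G kt I (1 : k) x.

Lemma diag_unit_linear : linear diag_unit.
Proof.
apply: gr_linear => [|a g x]; first exact: diag_pureBr.
rewrite diag_pure_gr; apply: (congr1 (fun m : kt => @diag_pure k G kt I m _)).
rewrite [RHS]/(augmentation _ * (1 : k)) augmentationU.
exact: (esym (mulr1 (1 : k))).
Qed.

Lemma diag_unit_inj : injective diag_unit.
Proof.
have [||a m x|f [fB fE]] := diag_lift (M := kt) (I := I)
    (b := fun (m : k) x => (gr_of m 1%g : R^c) *: x).
- by move=> m x y; rewrite scalerBr.
- by move=> x m m'; rewrite gr_ofB scalerBl.
- rewrite [RHS]scalerA; apply: (congr1 (fun u : R^c => u *: x)).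
  rewrite [in LHS]/(_ *: m) /= /triv_scale augmentationU.
  by rewrite [RHS]gr_ofM mulg1.
by apply: (can_inj (g := f)) => x; rewrite fE [LHS]scale1r.
Qed.
End Unit.

Lemma finite_sfliP (S : pzRingType) : ltE (sfli S) Infty ->
  exists d, forall I : lmodType S, injective_module I ->
    exists r : resolution (@flat_module S) I, length_le r d.
Proof.
case E : (sfli S) => [d|] // _.
have : leE (sfli S) (Fin d) by rewrite E /=.
case/least_leP => m _ Hm; exists m => I iI.
have /least_leP[n nm [r rn]] : leE (flat_dim I) (Fin m) by apply: Hm; exists I.
by exists r => i mi; apply: rn; apply: leq_ltn_trans mi.
Qed.

(** The map of I into its diagonal tensor product with the hull A of the trivial
    module is injective, hence splits because I is injective. Thus I inherits the
    purity of A. *)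
Lemma injective_tensor_syzygy (n : nat) (I : lmodType R^c) :
  ltE (sfli k) Infty ->
  (exists s : resolution (@gorenstein_projective R) kt, length_le s n) ->
  injective_module I ->
  forall (L P Z : lmodType R) (i : {linear L -> P}) (p : {linear P -> Z}),
    short_exact i p -> projective_module P -> gorenstein_filtered Z ->
    injective (tensor_map (idfun : {linear I -> I}) i).
Proof.
case/finite_sfliP => d dP s injI L P Z i p se pP fZ.
have [r rd] := dP _ (right_restrict_injective injI).
have [A [Y [a [b [sea fY gA]]]]] :=
  hull_exists rd (left_flat_tor_acyclic trivial_restrict_dual_basis) s.
pose J : {linear I -> diagonal_tensor A I} := diag_map I a \o to_linear (@diag_unit_linear I).
have JI : injective J.
  have aI := diag_map_inj sea (@filtered_tor_acyclic _ _ _ _ _ _ rd fY 0%N).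
  by move=> x y /aI; apply: (@diag_unit_inj I).
have [rho rhoE] := injI _ _ J (idfun : {linear I -> I}) JI.
apply: inj_ker0 => [|t t0]; first exact: tensor_mapB.
have Jt : tensor_map J (idfun : {linear L -> L}) t = 0.
  apply: (inj_eq0 (@triple_mapB _ _ _ _ _ _ _ _ _) (gA _ _ _ i p se pP fZ)).
  rewrite triple_map_idl -tensor_map_exchange t0.
  exact/zmod_morphism0/tensor_mapB.
rewrite -[t](tensor_map_id (f := rho \o J) (g := idfun)) //.
rewrite -(tensor_map_comp (f := J) (f' := rho) (g := idfun) (g' := idfun)) //.
by rewrite Jt; apply/zmod_morphism0/tensor_mapB.
Qed.

(** Exactness of the tensored complex at a degree says that I preserves the
    inclusion of the cycles below it, which are again Gorenstein projective. *)
Lemma complete_projective_flat (n : nat) (C : complex R) :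
  ltE (sfli k) Infty ->
  (exists s : resolution (@gorenstein_projective R) kt, length_le s n) ->
  complete_projective_resolution C -> complete_flat_resolution C.
Proof.
move=> hk s cC; have [aC pC _] := cC.
split; [exact: aC|by move=> m; apply: projective_flat|move=> I injI m].
case: (int_succ m) => m' ->.
have syz l : exists (K : lmodType R) (j : {linear K -> C (l + 1)}),
    [/\ injective j, is_exact j (cdiff C l) & gorenstein_projective K].
  have [K [j [jI jex]]] := kernel_exists (cdiff C l).
  by exists K, j; split=> //; exists C => //; exists l, j.
(* K is the module of cycles in degree l + 2, and Z, its cosyzygy, the module of
   cycles in degree l + 1. *)
have [K [j [jI jex _]]] := syz m'.
case: (int_succ m') j jI jex => l -> j jI jex.
have [Z [z [zI zex gZ]]] := syz l.
have [p [pE pS pex]] := cycle_cover aC jI jex.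
have [q [qE qS _]] := cycle_cover aC zI zex.
have se : short_exact j q.
  split=> // y; rewrite -jex -qE; split=> [->|/(linear_eq0 zI)//]; exact: linear0.
have inj := injective_tensor_syzygy hk s injI se (pC _) (filtered_gp gZ).
have pI := tensor_exactr (N := I) pex pS.
have E t : tensor_map (idfun : {linear I -> I}) (cdiff C (l + 1 + 1)) t =
    tensor_map (idfun : {linear I -> I}) j (tensor_map (idfun : {linear I -> I}) p t).
  by rewrite (tensor_map_comp (f'' := idfun) (g'' := cdiff C (l + 1 + 1))).
move=> t; rewrite E; split=> [/(inj_eq0 (@tensor_mapB _ _ _ _ _ _ _) inj)/pI //|].
by move/pI => ->; apply/zmod_morphism0/tensor_mapB.
Qed.

Lemma resolution_impl (S : pzRingType) (X Y : lmodType S -> Prop) (M : lmodType S) n :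
  (forall N, X N -> Y N) ->
  (exists s : resolution X M, length_le s n) ->
  exists s : resolution Y M, length_le s n.
Proof.
move=> XY [s sn].
by exists (Resolution (fun i => XY _ (robjP s i)) (@raug_surj _ _ _ s)
  (@raug_exact _ _ _ s) (@rdiff_exact _ _ _ s)).
Qed.
End Comparison.

Theorem theorem1p1 (k : comPzRingType) (G : groupType)
  (hk : ltE (sfli k) Infty) : leE (Ghd k G) (Gcd k G).
Proof.
case E : (Gcd k G) => [n|]; last by case: (Ghd k G).
have /least_leP[m mn s] : leE (Gcd k G) (Fin n) by rewrite E /=.
apply/least_leP; exists m => //; apply: resolution_impl (s) => M [C cC syzM].
exists C; [exact: complete_projective_flat hk s cC|exact: syzM].
Qed.
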